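(* Let $A$ be a Banach algebra with a bounded approximate identity. Then the following are equivalent: (i) $A$ is amenable; (ii) $A\widehat{\otimes}A$ is amenable; (iii) $A\widehat{\otimes}A^{op}$ is amenable.
   Context: $\widehat{\otimes}$ denotes the projective tensor product of Banach spaces; for Banach algebras $A,B$, $A\widehat{\otimes}B$ is a Banach algebra with product determined by $(a\otimes b)(c\otimes d)=ac\otimes bd$. $A^{op}$ is the Banach algebra obtained from $A$ by reversing the product. A bounded approximate identity is two-sided: a bounded net $(e_i)$ in $A$ with $e_ia\to a$ and $ae_i\to a$ in norm for all $a\in A$. A Banach $A$-bimodule is a Banach space $X$ that is an $A$-bimodule for which there is a constant $C>0$ with $\|a.x\|\le C\|a\|\|x\|$ and $\|x.a\|\le C\|a\|\|x\|$ for all $a\in A$, $x\in X$. Its dual $X^*$ is a Banach $A$-bimodule via $\langle a.f,x\rangle=\langle f,x.a\rangle$ and $\langle f.a,x\rangle=\langle f,a.x\rangle$. A derivation $D:A\to X$ is a linear map with $D(ab)=a.D(b)+D(a).b$; it is inner if there is $x\in X$ with $D(a)=a.x-x.a$ for all $a\in A$. A Banach algebra $A$ is amenable if for every Banach $A$-bimodule $X$, every continuous derivation from $A$ into the dual bimodule $X^*$ is inner. *)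

(* Defs.v *)
From HB Require Import structures.
From mathcomp Require Import all_boot all_order all_algebra.
From mathcomp Require Import all_classical all_reals topology normedtype.
From mathcomp Require Import complex.
From mathcomp Require Import lra.

Set Implicit Arguments.
Unset Strict Implicit.
Unset Printing Implicit Defensive.

Import Order.TTheory GRing.Theory Num.Theory numFieldNormedType.Exports.

Local Open Scope classical_set_scope.
Local Open Scope ring_scope.
Local Open Scope complex_scope.
Local Open Scope quotient_scope.

(* The norm of a [normedModType R[i]] takes its values in [R[i]]; [rnorm] is
   the same number seen in [R], where infima and suprema are available. *)
Definition rnorm (R : realType) (V : normedZmodType R[i]) (x : V) : R :=
  complex.Re `|x|.

Section rnorm.
Variable R : realType.
Implicit Type V : normedZmodType R[i].

Lemma rnormE V (x : V) : (rnorm x)%:C = `|x|.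
Proof. by rewrite /rnorm RRe_real// ger0_real. Qed.

Lemma rnorm_ge0 V (x : V) : 0 <= rnorm x.
Proof. by rewrite -ler0c rnormE. Qed.

Lemma rnormD V (x y : V) : rnorm (x + y) <= rnorm x + rnorm y.
Proof. by rewrite -lecR rmorphD/= !rnormE ler_normD. Qed.

Lemma rnorm_eq0 V (x : V) : rnorm x = 0 -> x = 0.
Proof. by move=> x0; apply/normr0_eq0; rewrite -rnormE x0. Qed.

Lemma rnorm0 V : rnorm (0 : V) = 0.
Proof. by apply: complexI; rewrite rnormE normr0. Qed.

Lemma rnormN V (x : V) : rnorm (- x) = rnorm x.
Proof. by rewrite /rnorm normrN. Qed.

Lemma rnormZ (V : normedModType R[i]) (k : R[i]) (x : V) :
  rnorm (k *: x) = rnorm k * rnorm x.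
Proof. by apply: complexI; rewrite rmorphM/= !rnormE normrZ. Qed.

Lemma rnormM (x y : R[i]) : rnorm (x * y) = rnorm x * rnorm y.
Proof. by apply: complexI; rewrite rmorphM/= !rnormE normrM. Qed.

Lemma rnorm_def (a b : R) : rnorm (a +i* b) = Num.sqrt (a ^+ 2 + b ^+ 2).
Proof. by []. Qed.

Lemma rnorm_Re (z : R[i]) : `|complex.Re z| <= rnorm z.
Proof. by rewrite -lecR rnormE; exact: normc_ge_Re. Qed.

Lemma rnorm_Im (z : R[i]) : `|complex.Im z| <= rnorm z.
Proof.
case: z => a b; rewrite rnorm_def /= -sqrtr_sqr ler_wsqrtr//.
by rewrite lerDr sqr_ge0.
Qed.

Lemma rnorm_le (z : R[i]) : rnorm z <= `|complex.Re z| + `|complex.Im z|.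
Proof.
case: z => a b; rewrite rnorm_def /=.
rewrite -[leRHS]ger0_norm ?addr_ge0// -sqrtr_sqr ler_wsqrtr//.
rewrite sqrrD !real_normK ?num_real// -addrA lerD2l lerDr.
by rewrite mulrn_wge0// mulr_ge0.
Qed.

Lemma ltr0c (x : R) : (0 < x%:C) = (0 < x).
Proof. exact: (ltcR 0 x). Qed.

End rnorm.

Lemma archi_inv (R : realType) (e : R) : 0 < e ->
  exists N, forall n, (N <= n)%N -> n.+1%:R^-1 < e.
Proof.
move=> ep; exists (Num.truncn e^-1) => n Nn.
rewrite -[ltRHS]invrK ltf_pV2 ?posrE ?invr_gt0//.
by rewrite (lt_le_trans (truncnS_gt e^-1))// ler_nat.
Qed.

Section sequences.
Variables (R : realType) (V : zmodType) (p : V -> R).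

Definition cauchy_for (u : nat -> V) :=
  forall e, 0 < e -> exists N, forall m n, (N <= m)%N -> (N <= n)%N ->
    p (u m - u n) < e.

Definition cvg_for (u : nat -> V) (l : V) :=
  forall e, 0 < e -> exists N, forall n, (N <= n)%N -> p (l - u n) < e.

End sequences.

HB.factory Record Lmodule_isBanach (R : realType) V
    & GRing.Lmodule R[i] V := {
  bnorm : V -> R ;
  bnormD : forall x y, bnorm (x + y) <= bnorm x + bnorm y ;
  bnormZ : forall (k : R[i]) x, bnorm (k *: x) = rnorm k * bnorm x ;
  bnorm_eq0 : forall x, bnorm x = 0 -> x = 0 ;
  bnorm_complete : forall u : nat -> V, cauchy_for bnorm u ->
    exists l, cvg_for bnorm u l
}.

HB.builders Context R V & Lmodule_isBanach R V.

Let norm (x : V) : R[i] := (bnorm x)%:C.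

Let normD x y : norm (x + y) <= norm x + norm y.
Proof. by rewrite /norm -rmorphD/= lecR bnormD. Qed.

Let normZ (k : R[i]) x : norm (k *: x) = `|k| * norm x.
Proof. by rewrite /norm bnormZ rmorphM/= rnormE. Qed.

Let norm_eq0 x : norm x = 0 -> x = 0.
Proof. by move=> /complexI/bnorm_eq0. Qed.

HB.instance Definition _ :=
  Lmodule_isNormed.Build R[i] V normD normZ norm_eq0.

Let bnormE (x : V) : `|x| = (bnorm x)%:C. Proof. by []. Qed.

Let ballE (x : V) (e : R) y : ball x e%:C y <-> bnorm (x - y) < e.
Proof. by rewrite -ball_normE /ball_/= bnormE ltcR. Qed.

Let complete (F : set_system V) : ProperFilter F -> cauchy F -> cvg F.
Proof.
move=> FF /cauchyP Fc.
have e0 n : 0 < (n.+1%:R^-1 : R) by rewrite invr_gt0.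
have /choice[u uF] n : exists x, F (ball x (n.+1%:R^-1 : R)%:C).
  by apply: Fc; rewrite ltr0c.
have uu m n : bnorm (u m - u n) < m.+1%:R^-1 + n.+1%:R^-1.
  have [y [/ballE ym /ballE yn]] := filter_ex (filterI (uF m) (uF n)).
  rewrite -(subrK y (u m)) -addrA (le_lt_trans (bnormD _ _))// ltrD//.
  by move: yn; rewrite -opprB -scaleN1r bnormZ {1}/rnorm normrN normr1 mul1r.
have [e ep|l ul] := @bnorm_complete u.
  have [N NP] := archi_inv (divr_gt0 ep (ltr0Sn _ 1)).
  exists N => m n Nm Nn; rewrite (lt_trans (uu _ _))// [ltRHS]splitr.
  by rewrite ltrD// NP.
apply/cvg_ex; exists l; apply/cvgrPdist_lt => e ep.
have [r re] : exists r : R, e = r%:C.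
  by exists (complex.Re e); rewrite RRe_real// gtr0_real.
rewrite {e}re in ep *; move: ep; rewrite ltr0c => ep.
have r2 : 0 < r / 2 by rewrite divr_gt0.
have [N NP] := ul _ r2; have [M MP] := archi_inv r2.
have := uF (maxn N M); apply: filterS => y /ballE uy.
rewrite bnormE ltcR -(subrK (u (maxn N M)) l) -addrA.
rewrite (le_lt_trans (bnormD _ _))// [ltRHS]splitr ltrD ?NP ?leq_maxl//.
by rewrite (lt_trans uy)// MP// leq_maxr.
Qed.

HB.instance Definition _ := Uniform_isComplete.Build V complete.

HB.end.

Section complete_scalars.
Variable R : realType.

Lemma real_complete (u : nat -> R) : cauchy_for Num.norm u ->
  exists l, cvg_for Num.norm u l.
Proof.
move=> uc; have /cvg_ex[l ul] : cvg (u @ \oo).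
  apply: cauchy_cvg; apply/cauchyP => e e0; have [N NP] := uc _ e0.
  by exists (u N); exists N => // n /= Nn; rewrite -ball_normE/= NP.
exists l => e e0; have /cvgrPdist_lt/(_ _ e0)[N _ NP] := ul.
by exists N => n Nn; apply: NP.
Qed.

Lemma complex_complete (u : nat -> R[i]^o) :
  cauchy_for (@rnorm R R[i]^o) u -> exists l, cvg_for (@rnorm R R[i]^o) u l.
Proof.
move=> uc.
have [a ua] : exists a, cvg_for Num.norm (fun n => complex.Re (u n)) a.
  apply: real_complete => e /uc[N NP]; exists N => m n Nm Nn.
  rewrite (le_lt_trans _ (NP _ _ Nm Nn))// (le_trans _ (rnorm_Re _))//.
  by case: (u m) (u n) => [? ?] [? ?].
have [b ub] : exists b, cvg_for Num.norm (fun n => complex.Im (u n)) b.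
  apply: real_complete => e /uc[N NP]; exists N => m n Nm Nn.
  rewrite (le_lt_trans _ (NP _ _ Nm Nn))// (le_trans _ (rnorm_Im _))//.
  by case: (u m) (u n) => [? ?] [? ?].
exists (a +i* b) => e e0; have e2 : 0 < e / 2 by rewrite divr_gt0.
have [N NP] := ua _ e2; have [M MP] := ub _ e2.
exists (maxn N M) => n; rewrite geq_max => /andP[Nn Mn].
rewrite (le_lt_trans (rnorm_le _))// [ltRHS]splitr ltrD//.
  by have := NP _ Nn; case: (u n).
by have := MP _ Mn; case: (u n).
Qed.

End complete_scalars.

Section dual.
Variables (R : realType) (X : normedModType R[i]).

Definition continuous_functional : {pred X -> R[i]^o} :=
  fun f => `[< linear f /\ continuous f >].

(* The scalars are [R[i]^o] because [R[i]] is canonically a module over [R]. *)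
Record dual := Dual {
  dual_fun :> X -> R[i]^o ;
  dualP : dual_fun \in continuous_functional }.

HB.instance Definition _ := [isSub for dual_fun].
HB.instance Definition _ := [Choice of dual by <:].

Lemma dual_linear (f : dual) : linear f.
Proof. by have /asboolP[] := dualP f. Qed.

HB.instance Definition _ (f : dual) :=
  GRing.isLinear.Build R[i] X R[i]^o *:%R f (@dual_linear f).

Lemma continuous_functionalP (f : X -> R[i]^o) : linear f ->
  (exists M : R, forall x, rnorm (f x) <= M * rnorm x) ->
  f \in continuous_functional.
Proof.
move=> lf [M fM]; apply/asboolP; split=> //.
pose L := GRing.isLinear.Build R[i] X R[i]^o *:%R f lf.
pose F : {linear X -> R[i]^o} := HB.pack f L.
apply: (@bounded_linear_continuous _ _ _ F); apply/linear_boundedP.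
exists M%:C; split; first by rewrite complex_real.
move=> r Mr x; rewrite -!rnormE (le_trans (y := M%:C * (rnorm x)%:C))//.
  by rewrite -rmorphM/= lecR fM.
by rewrite ler_wpM2r ?ler0c ?rnorm_ge0// ltW.
Qed.

Lemma dual_bounded (f : dual) :
  exists2 M : R, 0 <= M & forall x, rnorm (f x) <= M * rnorm x.
Proof.
have /asboolP[_ fc] := dualP f.
have /linear_boundedP := continuous_linear_bounded 0 (fc 0).
move=> /pinfty_ex_gt0[M M0 fM]; exists (complex.Re M).
  by rewrite -ler0c RRe_real ?ltW// gtr0_real.
move=> x; have := fM x.
by rewrite -!rnormE -{1}(RRe_real (gtr0_real M0)) -rmorphM/= lecR.
Qed.

Fact continuous_functional_submod : submod_closed continuous_functional.
Proof.
split.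
  apply: continuous_functionalP.
    by move=> k x y; rewrite /= scaler0 addr0.
  by exists 0 => x; rewrite rnorm0 mul0r.
move=> k f g fP gP.
pose f' := Dual fP; pose g' := Dual gP.
apply: continuous_functionalP.
  have fgE z : (k *: f + g) z = k *: f' z + g' z by [].
  move=> l x y; rewrite !fgE !dual_linear.
  by rewrite !scalerDr addrACA !scalerA mulrC.
have [M _ fM] := dual_bounded f'; have [N _ gN] := dual_bounded g'.
exists (rnorm k * M + N) => x; rewrite (le_trans (rnormD _ _))// mulrDl.
rewrite lerD ?gN// -mulrA.
by have := @rnormZ R R[i]^o k (f x) => ->; rewrite ler_wpM2l ?rnorm_ge0 ?fM.
Qed.

HB.instance Definition _ := GRing.isSubmodClosed.Build R[i] (X -> R[i]^o)
  continuous_functional continuous_functional_submod.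
HB.instance Definition _ :=
  [SubChoice_isSubLmodule of dual by <:].

Lemma dualD (f g : dual) x : (f + g) x = f x + g x. Proof. by []. Qed.
Lemma dualB (f g : dual) x : (f - g) x = f x - g x. Proof. by []. Qed.
Lemma dualZ (k : R[i]) (f : dual) x : (k *: f) x = k *: (f x).
Proof. by []. Qed.

Lemma dual_eq (f g : dual) : (forall x, f x = g x) -> f = g.
Proof. by move=> fg; apply/val_inj/funext. Qed.

Definition dual_norm (f : dual) : R :=
  sup [set rnorm (f x) | x in [set x | rnorm x <= 1]].

Lemma dual_norm_has_sup (f : dual) :
  has_sup [set rnorm (f x) | x in [set x | rnorm x <= 1]].
Proof.
split; first by exists (rnorm (f 0)), 0 => //=; rewrite rnorm0.
have [M M0 fM] := dual_bounded f; exists M => _ [x /= x1 <-].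
by rewrite (le_trans (fM x))// ler_piMr.
Qed.

Lemma dual_norm_ge0 (f : dual) : 0 <= dual_norm f.
Proof.
apply: (le_trans (rnorm_ge0 (f 0))).
by apply: sup_upper_bound; [exact: dual_norm_has_sup|exists 0; rewrite //= rnorm0].
Qed.

Lemma le_dual_norm (f : dual) x : rnorm (f x) <= dual_norm f * rnorm x.
Proof.
have [x0|x0] := eqVneq (rnorm x) 0.
  by rewrite (rnorm_eq0 x0) linear0 !rnorm0 mulr0.
have xp : 0 < rnorm x by rewrite lt_neqAle eq_sym x0 rnorm_ge0.
have rk : rnorm ((rnorm x)^-1%:C : R[i]) = (rnorm x)^-1.
  by apply: complexI; rewrite rnormE ger0_norm// ler0c invr_ge0 ltW.
rewrite -ler_pdivrMr// mulrC.
rewrite -rk -[X in X <= _](@rnormZ R R[i]^o) -linearZ.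
apply: sup_upper_bound; first exact: dual_norm_has_sup.
by exists ((rnorm x)^-1%:C *: x) => //=; rewrite rnormZ rk mulVf.
Qed.

Lemma dual_norm_le (f : dual) (M : R) : (forall x, rnorm x <= 1 -> rnorm (f x) <= M) ->
  dual_norm f <= M.
Proof.
move=> fM; apply: ge_sup; first by case: (dual_norm_has_sup f).
by move=> _ [x x1 <-]; exact: fM.
Qed.

Fact dual_normD (f g : dual) : dual_norm (f + g) <= dual_norm f + dual_norm g.
Proof.
apply: dual_norm_le => x x1; rewrite dualD (le_trans (rnormD _ _))//.
by rewrite lerD// (le_trans (le_dual_norm _ _))// ler_piMr// dual_norm_ge0.
Qed.

Fact dual_normZ (k : R[i]) (f : dual) : dual_norm (k *: f) = rnorm k * dual_norm f.
Proof.
have H l g : dual_norm (l *: g) <= rnorm l * dual_norm g.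
  apply: dual_norm_le => x x1; rewrite dualZ (@rnormZ R R[i]^o).
  rewrite ler_wpM2l ?rnorm_ge0// (le_trans (le_dual_norm _ _))//.
  by rewrite ler_piMr// dual_norm_ge0.
apply/eqP; rewrite eq_le H/=.
have [->|k0] := eqVneq k 0; first by rewrite rnorm0 mul0r dual_norm_ge0.
have kp : 0 < rnorm k.
  by rewrite lt_neqAle rnorm_ge0 andbT eq_sym; apply: contra_neq k0; exact: rnorm_eq0.
rewrite -ler_pdivlMl// -{1}(scalerK k0 f) (le_trans (H _ _))//.
rewrite ler_wpM2r ?dual_norm_ge0//.
rewrite -(ler_pM2l kp) mulfV ?gt_eqF// -rnormM mulfV//.
by rewrite -lecR rnormE normr1.
Qed.

Fact dual_norm_eq0 (f : dual) : dual_norm f = 0 -> f = 0.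
Proof.
move=> f0; apply: dual_eq => x; apply: rnorm_eq0; apply/eqP.
by rewrite eq_le rnorm_ge0 andbT (le_trans (le_dual_norm f x))// f0 mul0r.
Qed.

Fact dual_norm_complete (u : nat -> dual) : cauchy_for dual_norm u ->
  exists l, cvg_for dual_norm u l.
Proof.
move=> uc.
have /choice[f uf] x : exists l, cvg_for (@rnorm R R[i]^o) (u^~ x) l.
  apply: complex_complete => e e0.
  have x0 : 0 < rnorm x + 1 by rewrite ltr_wpDl// rnorm_ge0.
  have [|N NP] := uc (e / (rnorm x + 1)); first by rewrite divr_gt0.
  exists N => m n Nm Nn; rewrite -dualB (le_lt_trans (le_dual_norm _ _))//.
  have := NP _ _ Nm Nn; rewrite ltr_pdivlMr//; apply: le_lt_trans.
  by rewrite ler_wpM2l ?dual_norm_ge0// lerDl.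
have close e : 0 < e -> exists N, forall n x, (N <= n)%N ->
    rnorm (f x - u n x) <= e * rnorm x.
  move=> e0; have [N NP] := uc _ e0; exists N => n x Nn.
  apply/ler_addgt0Pr => d d0; have [M MP] := uf x _ d0.
  pose m := maxn N M; rewrite -(subrK (u m x) (f x)) -addrA addrC.
  rewrite (le_trans (rnormD _ _))// lerD//.
    rewrite -dualB (le_trans (le_dual_norm _ _))// ler_wpM2r ?rnorm_ge0//.
    by rewrite ltW// NP ?leq_maxl.
  by rewrite ltW// MP ?leq_maxr.
have fl : linear f.
  move=> k x y; apply/eqP; rewrite -subr_eq0; apply/eqP/rnorm_eq0/eqP.
  rewrite eq_le rnorm_ge0 andbT; apply/ler_addgt0Pr => d d0; rewrite add0r.
  pose M := rnorm (k *: x + y) + (rnorm k * rnorm x + rnorm y) + 1.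
  have M0 : 0 < M.
    by rewrite ltr_wpDl// !addr_ge0 ?mulr_ge0 ?rnorm_ge0.
  have [|N NP] := close (d / M); first by rewrite divr_gt0.
  pose z := k *: x + y.
  have -> : f z - (k *: f x + f y) =
      (f z - u N z) - (k *: (f x - u N x) + (f y - u N y)).
    have -> : u N z = k *: u N x + u N y by rewrite /z linearP.
    rewrite scalerBr [k *: f x - _ + _]addrACA -[- _ - _]opprD.
    by rewrite -[RHS]addrA -opprD [_ + (_ - _)]addrC subrK.
  rewrite (le_trans (rnormD _ _))// rnormN.
  rewrite (le_trans (y := d / M * rnorm z +
    (rnorm k * (d / M * rnorm x) + d / M * rnorm y)))//.
    rewrite lerD ?NP// (le_trans (rnormD _ _))// lerD ?NP//.
    by rewrite (@rnormZ R R[i]^o) ler_wpM2l ?rnorm_ge0// NP.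
  rewrite [X in _ + (X + _)]mulrCA -!mulrDr mulrAC ler_pdivrMr//.
  by rewrite ler_wpM2l ?(ltW d0)// /M lerDl.
have fP : f \in continuous_functional.
  apply: continuous_functionalP => //.
  have [N NP] := close _ ltr01; exists (1 + dual_norm (u N)) => x.
  rewrite -(subrK (u N x) (f x)) (le_trans (rnormD _ _))// mulrDl.
  by rewrite lerD ?NP// le_dual_norm.
exists (Dual fP) => e e0; have [|N NP] := close (e / 2).
  by rewrite divr_gt0.
exists N => n Nn; rewrite (@le_lt_trans _ _ (e / 2))//.
  apply: dual_norm_le => x x1; rewrite dualB (le_trans (NP _ _ Nn))//.
  by rewrite ler_piMr// divr_ge0// ltW.
by rewrite ltr_pdivrMr// ltr_pMr// ltr1n.
Qed.

HB.instance Definition _ := @Lmodule_isBanach.Build R dual dual_norm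
  dual_normD dual_normZ dual_norm_eq0 dual_norm_complete.

Lemma rnorm_dual (f : dual) : rnorm f = dual_norm f.
Proof. by []. Qed.

End dual.

Record seminorm (R : realType) (V : lmodType R[i]) := Seminorm {
  seminorm_fun :> V -> R ;
  seminormD : forall x y,
    seminorm_fun (x + y) <= seminorm_fun x + seminorm_fun y ;
  seminormZ : forall (k : R[i]) x,
    seminorm_fun (k *: x) = rnorm k * seminorm_fun x }.

Section seminorm_theory.
Variables (R : realType) (V : lmodType R[i]) (p : seminorm V).

Lemma seminorm0 : p 0 = 0.
Proof. by rewrite -(scale0r 0) seminormZ rnorm0 mul0r. Qed.

Lemma seminormN x : p (- x) = p x.
Proof.
by rewrite -scaleN1r seminormZ rnormN {1}/rnorm normr1 mul1r.
Qed.

Lemma seminormC x y : p (x - y) = p (y - x).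
Proof. by rewrite -seminormN opprB. Qed.

Lemma seminorm_ge0 x : 0 <= p x.
Proof.
have := seminormD p x (- x); rewrite subrr seminorm0 seminormN.
by rewrite -mulr2n pmulrn_lge0.
Qed.

Lemma seminorm_triangle y x z : p (x - z) <= p (x - y) + p (y - z).
Proof. by rewrite (le_trans _ (seminormD _ _ _))// addrA subrK. Qed.

Lemma seminorm_dist x y : `|p x - p y| <= p (x - y).
Proof.
have H a b : p a - p b <= p (a - b).
  by rewrite lerBlDr (le_trans _ (seminormD _ _ _))// subrK.
by rewrite ler_norml H andbT lerNl opprB seminormC H.
Qed.

Lemma cvg_for_unique (u : nat -> R) a b :
  cvg_for Num.norm u a -> cvg_for Num.norm u b -> a = b.
Proof.
move=> ua ub; apply/eqP; rewrite -subr_eq0 -normr_le0.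
apply/ler_addgt0Pr => e e0; rewrite add0r.
have e2 : 0 < e / 2 by rewrite divr_gt0.
have [N NP] := ua _ e2; have [M MP] := ub _ e2.
rewrite (le_trans (ler_distD (u (maxn N M)) _ _))// [leRHS]splitr.
by rewrite lerD// ltW// ?NP ?leq_maxl// distrC MP// leq_maxr.
Qed.

Definition cauchy_pred : {pred nat -> V} := fun u => `[< cauchy_for p u >].

Record cauchy_seq := CauchySeq {
  cauchy_fun :> nat -> V ;
  cauchy_seqP : cauchy_fun \in cauchy_pred }.

HB.instance Definition _ := [isSub for cauchy_fun].
HB.instance Definition _ := [Choice of cauchy_seq by <:].

Lemma cauchy_seq_cauchy (u : cauchy_seq) : cauchy_for p u.
Proof. exact/asboolP/cauchy_seqP. Qed.

Fact cauchy_pred_submod : submod_closed cauchy_pred.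
Proof.
split.
  by apply/asboolP => e e0; exists 0%N => m n _ _; rewrite subrr seminorm0.
move=> k u v /asboolP uc /asboolP vc; apply/asboolP => e e0.
have k1 : 0 < rnorm k + 1 by rewrite ltr_wpDl// rnorm_ge0.
have [|N NP] := uc (e / 2 / (rnorm k + 1)); first by rewrite !divr_gt0.
have [|M MP] := vc (e / 2); first by rewrite divr_gt0.
exists (maxn N M) => m n; rewrite !geq_max => /andP[Nm Mm] /andP[Nn Mn].
have -> : (k *: u + v) m - (k *: u + v) n = k *: (u m - u n) + (v m - v n).
  by rewrite scalerBr addrACA opprD.
rewrite (le_lt_trans (seminormD _ _ _))// [ltRHS]splitr ltr_leD ?(ltW (MP _ _ _ _))//.
rewrite seminormZ (@le_lt_trans _ _ ((rnorm k + 1) * p (u m - u n)))//.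
  by rewrite ler_wpM2r ?seminorm_ge0// lerDl.
by rewrite mulrC -ltr_pdivlMr// NP.
Qed.

HB.instance Definition _ := GRing.isSubmodClosed.Build R[i] (nat -> V)
  cauchy_pred cauchy_pred_submod.
HB.instance Definition _ := [SubChoice_isSubLmodule of cauchy_seq by <:].

Definition null_pred : {pred cauchy_seq} := fun u => `[< cvg_for p u 0 >].

Lemma null_predP (u : cauchy_seq) :
  reflect (forall e, 0 < e -> exists N, forall n, (N <= n)%N -> p (u n) < e)
    (u \in null_pred).
Proof.
apply: (iffP idP) => [/asboolP uc|uc]; last apply/asboolP.
  by move=> e /uc[N NP]; exists N => n /NP; rewrite sub0r seminormN.
by move=> e /uc[N NP]; exists N => n /NP; rewrite sub0r seminormN.
Qed.

Fact null_pred_submod : submod_closed null_pred.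
Proof.
split.
  by apply/null_predP => e e0; exists 0%N => n _; rewrite seminorm0.
move=> k u v /null_predP uc /null_predP vc; apply/null_predP => e e0.
have k1 : 0 < rnorm k + 1 by rewrite ltr_wpDl// rnorm_ge0.
have [|N NP] := uc (e / 2 / (rnorm k + 1)); first by rewrite !divr_gt0.
have [|M MP] := vc (e / 2); first by rewrite divr_gt0.
exists (maxn N M) => n; rewrite geq_max => /andP[Nn Mn].
rewrite (le_lt_trans (seminormD _ _ _))// [ltRHS]splitr ltr_leD ?(ltW (MP _ _))//.
rewrite seminormZ (@le_lt_trans _ _ ((rnorm k + 1) * p (u n)))//.
  by rewrite ler_wpM2r ?seminorm_ge0// lerDl.
by rewrite mulrC -ltr_pdivlMr// NP.
Qed.

HB.instance Definition _ := GRing.isSubmodClosed.Build R[i] cauchy_seq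
  null_pred null_pred_submod.

Definition completion : Type := Quotient.quot null_pred.

HB.instance Definition _ := Choice.on completion.
HB.instance Definition _ := GRing.Zmodule.on completion.
HB.instance Definition _ := EqQuotient.on completion.


Definition cls (u : cauchy_seq) : completion := \pi_(Quotient.quot null_pred) u.

Lemma cls_eqP (u v : cauchy_seq) : reflect (cls u = cls v) (u - v \in null_pred).
Proof. by rewrite Quotient.idealrBE; exact: eqP. Qed.

Lemma cls_repr (x : completion) : cls (repr x) = x.
Proof. exact: reprK. Qed.

Lemma clsB u v : cls (u - v) = cls u - cls v.
Proof. by rewrite /cls !piE. Qed.

Lemma clsD u v : cls (u + v) = cls u + cls v.
Proof. by rewrite /cls !piE. Qed.

Definition completion_scale (k : R[i]) (x : completion) : completion :=
  cls (k *: repr x).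

Lemma clsZ k u : completion_scale k (cls u) = cls (k *: u).
Proof.
apply/cls_eqP; rewrite -scalerBr rpredZ//; apply/cls_eqP; exact: cls_repr.
Qed.

Fact completion_scaleA k l x :
  completion_scale k (completion_scale l x) = completion_scale (k * l) x.
Proof. by rewrite -(cls_repr x) !clsZ scalerA. Qed.

Fact completion_scale1 : left_id 1 completion_scale.
Proof. by move=> x; rewrite -(cls_repr x) clsZ scale1r. Qed.

Fact completion_scaleDr : right_distributive completion_scale +%R.
Proof.
move=> k x y.
by rewrite -(cls_repr x) -(cls_repr y) -clsD !clsZ scalerDr clsD.
Qed.

Fact completion_scaleDl x :
  {morph completion_scale^~ x : k l / k + l >-> k + l}.
Proof. by move=> k l; rewrite -(cls_repr x) !clsZ scalerDl clsD. Qed.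

HB.instance Definition _ := GRing.Zmodule_isLmodule.Build R[i] completion
  completion_scaleA completion_scale1 completion_scaleDr completion_scaleDl.

Lemma cls_scale k u : cls (k *: u) = k *: cls u.
Proof. by rewrite -clsZ. Qed.

Definition completion_norm (x : completion) : R :=
  lim (p (repr x n) @[n --> \oo]).

Lemma completion_normP (u : cauchy_seq) :
  cvg_for Num.norm (fun n => p (u n)) (completion_norm (cls u)).
Proof.
have [l ul] : exists l, cvg_for Num.norm (fun n => p (repr (cls u) n)) l.
  apply: real_complete => e /(cauchy_seq_cauchy (repr (cls u)))[N NP].
  exists N => m n Nm Nn.
  by rewrite (le_lt_trans (seminorm_dist _ _))// NP.
have -> : completion_norm (cls u) = l.
  apply: cvg_lim; first exact: norm_hausdorff.
  by apply/cvgrPdist_lt => e /ul[N NP]; exists N.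
move=> e e0; have e2 : 0 < e / 2 by rewrite divr_gt0.
have [N NP] := ul _ e2.
have /cls_eqP/null_predP/(_ _ e2)[M MP] := cls_repr (cls u).
exists (maxn N M) => n; rewrite geq_max => /andP[Nn Mn].
rewrite (le_lt_trans (ler_distD (p (repr (cls u) n)) _ _))// [ltRHS]splitr.
by rewrite ltrD ?NP// (le_lt_trans (seminorm_dist _ _))// MP.
Qed.

Lemma completion_norm_le (u : cauchy_seq) M N :
  (forall n, (N <= n)%N -> p (u n) <= M) -> completion_norm (cls u) <= M.
Proof.
move=> uM; apply/ler_addgt0Pr => e /(completion_normP u)[K KP].
have := KP (maxn N K) (leq_maxr _ _); rewrite ltr_norml => /andP[_].
rewrite ltrBlDr => /ltW/le_trans; apply.
by rewrite addrC lerD2r uM// leq_maxl.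
Qed.

Lemma completion_norm_lt (u : cauchy_seq) M : completion_norm (cls u) < M ->
  exists N, forall n, (N <= n)%N -> p (u n) < M.
Proof.
rewrite -subr_gt0 => /(completion_normP u)[N NP]; exists N => n /NP.
rewrite ltr_norml => /andP[+ _].
by rewrite ltrNl opprB ltrD2r.
Qed.

Lemma completion_norm_const (u : cauchy_seq) M :
  (forall n, p (u n) = M) -> completion_norm (cls u) = M.
Proof.
move=> uM; apply: cvg_for_unique (completion_normP u) _ => e e0.
by exists 0%N => n _; rewrite uM subrr normr0.
Qed.

Fact completion_normD (x y : completion) :
  completion_norm (x + y) <= completion_norm x + completion_norm y.
Proof.
rewrite -(cls_repr x) -(cls_repr y) -clsD; set u := repr x; set v := repr y.
apply/ler_addgt0Pr => e e0; have e2 : 0 < e / 2 by rewrite divr_gt0.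
have [|N NP] := @completion_norm_lt u (completion_norm (cls u) + e / 2).
  by rewrite ltrDl.
have [|M MP] := @completion_norm_lt v (completion_norm (cls v) + e / 2).
  by rewrite ltrDl.
apply: (@completion_norm_le _ _ (maxn N M)) => n.
rewrite geq_max => /andP[Nn Mn]; rewrite (le_trans (seminormD _ _ _))//.
by rewrite (splitr e) addrACA lerD// ltW ?NP ?MP.
Qed.

Fact completion_normZ (k : R[i]) (x : completion) :
  completion_norm (k *: x) = rnorm k * completion_norm x.
Proof.
rewrite -(cls_repr x) -cls_scale; set u := repr x.
apply: cvg_for_unique (completion_normP (k *: u)) _ => e e0.
have k1 : 0 < rnorm k + 1 by rewrite ltr_wpDl// rnorm_ge0.
have [|N NP] := completion_normP u (e := e / (rnorm k + 1)).
  by rewrite divr_gt0.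
exists N => n Nn; rewrite seminormZ -mulrBr normrM ger0_norm ?rnorm_ge0//.
rewrite (@le_lt_trans _ _
  ((rnorm k + 1) * `|completion_norm (cls u) - p (u n)|))//.
  by rewrite ler_wpM2r// lerDl.
by rewrite mulrC -ltr_pdivlMr// NP.
Qed.

Fact completion_norm_eq0 (x : completion) : completion_norm x = 0 -> x = 0.
Proof.
rewrite -(cls_repr x) => x0; rewrite -[RHS](subrr (cls 0)) -clsB subr0.
apply/cls_eqP; rewrite subr0; apply/null_predP => e e0.
by apply: completion_norm_lt; rewrite x0.
Qed.

Fact completion_norm_complete (x : nat -> completion) :
  cauchy_for completion_norm x -> exists l, cvg_for completion_norm x l.
Proof.
move=> xc; pose u k : cauchy_seq := repr (x k).
have xE k : x k = cls (u k) by rewrite cls_repr.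
have /choice[t tP] k : exists t, forall m n, (t <= m)%N -> (t <= n)%N ->
    p (u k m - u k n) < k.+1%:R^-1.
  by apply: (cauchy_seq_cauchy (u k)); rewrite invr_gt0.
pose v k := u k (t k).
have uv k n : (t k <= n)%N -> p (u k n - v k) < k.+1%:R^-1.
  by move=> kn; apply: tP.
have vc : v \in cauchy_pred.
  apply/asboolP => e e0; have e3 : 0 < e / 3 by rewrite divr_gt0.
  have [N NP] := xc _ e3; have [M MP] := archi_inv e3.
  exists (maxn N M) => m n; rewrite !geq_max => /andP[Nm Mm] /andP[Nn Mn].
  have := NP _ _ Nm Nn; rewrite !xE -clsB => /completion_norm_lt[K KP].
  pose i := maxn K (maxn (t m) (t n)).
  have mi : (t m <= i)%N by rewrite !leq_max leqnn orbT.
  have ni : (t n <= i)%N by rewrite !leq_max leqnn !orbT.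
  rewrite (le_lt_trans (seminorm_triangle (u m i) _ _))//.
  have -> : e = e / 3 + (e / 3 + e / 3). by lra.
  rewrite ltrD//; first by rewrite seminormC (lt_trans (uv _ _ mi))// MP.
  rewrite (le_lt_trans (seminorm_triangle (u n i) _ _))// ltrD//.
    by rewrite KP// leq_maxl.
  by rewrite (lt_trans (uv _ _ ni))// MP.
exists (cls (CauchySeq vc)) => e e0; have e3 : 0 < e / 3 by rewrite divr_gt0.
have /asboolP/(_ _ e3)[N NP] := vc; have [M MP] := archi_inv e3.
exists (maxn N M) => k; rewrite geq_max => /andP[Nk Mk].
rewrite xE -clsB (@le_lt_trans _ _ (e / 3 + e / 3))//; last by lra.
apply: (@completion_norm_le _ _ (maxn N (t k))) => n.
rewrite geq_max => /andP[Nn kn].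
rewrite (le_trans (seminorm_triangle (v k) _ _))// lerD//.
  by rewrite ltW// NP.
by rewrite seminormC ltW// (lt_trans (uv _ _ kn))// MP.
Qed.

HB.instance Definition _ := @Lmodule_isBanach.Build R completion
  completion_norm completion_normD completion_normZ completion_norm_eq0
  completion_norm_complete.

Lemma rnorm_completion (x : completion) : rnorm x = completion_norm x.
Proof. by []. Qed.

End seminorm_theory.

Section completion_product.
Variables (R : realType) (V : lmodType R[i]) (p : seminorm V).
Variable m : V -> V -> V.
Hypothesis mDl : left_distributive m +%R.
Hypothesis mDr : right_distributive m +%R.
Hypothesis mZl : forall k x y, m (k *: x) y = k *: m x y.
Hypothesis mZr : forall k x y, m x (k *: y) = k *: m x y.
Hypothesis mA : associative m.
Hypothesis pm : forall x y, p (m x y) <= p x * p y.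

Let mBl x y z : m (x - y) z = m x z - m y z.
Proof. by rewrite mDl -scaleN1r mZl scaleN1r. Qed.

Let mBr x y z : m x (y - z) = m x y - m x z.
Proof. by rewrite mDr -scaleN1r mZr scaleN1r. Qed.

Lemma cauchy_seq_bounded (u : cauchy_seq p) : exists N M, 0 < M /\
  forall n, (N <= n)%N -> p (u n) <= M.
Proof.
have [N NP] := cauchy_seq_cauchy u ltr01; exists N, (1 + p (u N)).
split; first by rewrite ltr_pwDl// seminorm_ge0.
move=> n Nn; rewrite -(subrK (u N) (u n)) (le_trans (seminormD _ _ _))//.
by rewrite lerD2r ltW// NP.
Qed.

Fact cauchy_mul_subproof (u v : cauchy_seq p) :
  (fun n => m (u n) (v n)) \in cauchy_pred p.
Proof.
have [N [M [M0 uM]]] := cauchy_seq_bounded u.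
have [N' [M' [M'0 vM]]] := cauchy_seq_bounded v.
apply/asboolP => e e0.
have [|K KP] := cauchy_seq_cauchy u (e := e / 2 / M').
  by rewrite !divr_gt0.
have [|K' KP'] := cauchy_seq_cauchy v (e := e / 2 / M).
  by rewrite !divr_gt0.
exists (maxn (maxn N N') (maxn K K')) => i j.
rewrite !geq_max => /andP[/andP[Ni N'i] /andP[Ki K'i]].
move=> /andP[/andP[Nj N'j] /andP[Kj K'j]].
rewrite (le_lt_trans (seminorm_triangle p (m (u j) (v i)) _ _))//.
rewrite -mBl -mBr [ltRHS]splitr ltrD//.
  rewrite (le_lt_trans (pm _ _))//.
  rewrite (@le_lt_trans _ _ (p (u i - u j) * M'))//.
    by rewrite ler_wpM2l ?seminorm_ge0 ?vM.
  by rewrite -ltr_pdivlMr// KP.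
rewrite (le_lt_trans (pm _ _))//.
rewrite (@le_lt_trans _ _ (M * p (v i - v j)))//.
  by rewrite ler_wpM2r ?seminorm_ge0 ?uM.
by rewrite mulrC -ltr_pdivlMr// KP'.
Qed.

Definition cauchy_mul u v : cauchy_seq p := CauchySeq (cauchy_mul_subproof u v).

Definition completion_mul (x y : completion p) : completion p :=
  cls (cauchy_mul (repr x) (repr y)).

Lemma completion_mulE u v :
  completion_mul (cls u) (cls v) = cls (cauchy_mul u v).
Proof.
have /cls_eqP/null_predP uu := cls_repr (cls u).
have /cls_eqP/null_predP vv := cls_repr (cls v).
have [N [M [M0 uM]]] := cauchy_seq_bounded u.
have [N' [M' [M'0 vM]]] := cauchy_seq_bounded (repr (cls v)).
apply/cls_eqP/null_predP => e e0.
have [|K KP] := uu (e / 2 / M'); first by rewrite !divr_gt0.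
have [|K' KP'] := vv (e / 2 / M); first by rewrite !divr_gt0.
exists (maxn (maxn N N') (maxn K K')) => n.
rewrite !geq_max => /andP[/andP[Nn N'n] /andP[Kn K'n]].
set u' := repr (cls u); set v' := repr (cls v).
have -> : (cauchy_mul u' v' - cauchy_mul u v) n =
    m ((u' - u) n) (v' n) + m (u n) ((v' - v) n).
  by rewrite [(u' - u) n]/(u' n - u n) mBl [(v' - v) n]/(v' n - v n) mBr addrA subrK.
rewrite (le_lt_trans (seminormD _ _ _))// [ltRHS]splitr ltrD//.
  rewrite (le_lt_trans (pm _ _))//.
  rewrite (@le_lt_trans _ _ (p ((u' - u) n) * M'))//.
    by rewrite ler_wpM2l ?seminorm_ge0 ?vM.
  by rewrite -ltr_pdivlMr// KP.
rewrite (le_lt_trans (pm _ _))//.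
rewrite (@le_lt_trans _ _ (M * p ((v' - v) n)))//.
  by rewrite ler_wpM2r ?seminorm_ge0 ?uM.
by rewrite mulrC -ltr_pdivlMr// KP'.
Qed.

Lemma cauchy_seq_eq (u v : cauchy_seq p) : (forall n, u n = v n) -> u = v.
Proof. by move=> uv; apply/val_inj/funext. Qed.

Lemma completion_mulA : associative completion_mul.
Proof.
move=> x y z; rewrite -(cls_repr x) -(cls_repr y) -(cls_repr z).
by rewrite !completion_mulE; congr cls; apply: cauchy_seq_eq => n; exact: mA.
Qed.

Lemma completion_mulDl : left_distributive completion_mul +%R.
Proof.
move=> x y z; rewrite -(cls_repr x) -(cls_repr y) -(cls_repr z) -clsD.
by rewrite !completion_mulE -clsD; congr cls; apply: cauchy_seq_eq => n; exact: mDl.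
Qed.

Lemma completion_mulDr : right_distributive completion_mul +%R.
Proof.
move=> x y z; rewrite -(cls_repr x) -(cls_repr y) -(cls_repr z) -clsD.
by rewrite !completion_mulE -clsD; congr cls; apply: cauchy_seq_eq => n; exact: mDr.
Qed.

Lemma completion_mulZl k x y :
  completion_mul (k *: x) y = k *: completion_mul x y.
Proof.
rewrite -(cls_repr x) -(cls_repr y) -cls_scale !completion_mulE -cls_scale.
by congr cls; apply: cauchy_seq_eq => n; exact: mZl.
Qed.

Lemma completion_mulZr k x y :
  completion_mul x (k *: y) = k *: completion_mul x y.
Proof.
rewrite -(cls_repr x) -(cls_repr y) -cls_scale !completion_mulE -cls_scale.
by congr cls; apply: cauchy_seq_eq => n; exact: mZr.
Qed.

Lemma completion_norm_mul x y :
  `|completion_mul x y| <= `|x| * `|y|.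
Proof.
rewrite -!rnormE -rmorphM/= lecR.
rewrite -(cls_repr x) -(cls_repr y) completion_mulE.
set u := repr x; set v := repr y; rewrite !rnorm_completion.
have u0 : 0 <= completion_norm (cls u) := rnorm_ge0 (cls u).
have v0 : 0 <= completion_norm (cls v) := rnorm_ge0 (cls v).
apply/ler_addgt0Pr => e e0.
pose S := completion_norm (cls u) + completion_norm (cls v) + 1.
have S0 : 0 < S by rewrite ltr_wpDl// addr_ge0.
pose d := Num.min 1 (e / S).
have d0 : 0 < d by rewrite lt_min ltr01 divr_gt0.
have d1 : d <= 1 by rewrite ge_min lexx.
have dS : d * S <= e by rewrite -ler_pdivlMr// ge_min lexx orbT.
have [|N NP] := @completion_norm_lt _ _ p u (completion_norm (cls u) + d).
  by rewrite ltrDl.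
have [|M MP] := @completion_norm_lt _ _ p v (completion_norm (cls v) + d).
  by rewrite ltrDl.
apply: (@completion_norm_le _ _ _ _ _ (maxn N M)) => n.
rewrite geq_max => /andP[Nn Mn]; rewrite (le_trans (pm _ _))//.
rewrite (@le_trans _ _ ((completion_norm (cls u) + d) *
                        (completion_norm (cls v) + d)))//.
  by rewrite ler_pM ?seminorm_ge0// ltW ?NP ?MP.
by move: dS; rewrite /S; nra.
Qed.

End completion_product.

(* Bilinear forms separate the points of the algebraic tensor product of two
   vector spaces. It is therefore realised as the space of the functionals
   phi |-> phi a1 b1 + ... + phi an bn on bilinear forms. *)
Section algebraic_tensor_product.
Variables (K : fieldType) (A B : lmodType K).

Definition tensor_sum (s : seq (A * B)) : {bilinear A -> B -> K^o} -> K^o :=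
  fun phi => \sum_(x <- s) phi x.1 x.2.

Definition is_tensor : {pred {bilinear A -> B -> K^o} -> K^o} :=
  fun u => `[< exists s, u = tensor_sum s >].

Record tensor := Tensor {
  tensor_fun :> {bilinear A -> B -> K^o} -> K^o ;
  tensorP : tensor_fun \in is_tensor }.

HB.instance Definition _ := [isSub for tensor_fun].
HB.instance Definition _ := [Choice of tensor by <:].

Lemma tensor_sum_cat s t phi :
  tensor_sum (s ++ t) phi = tensor_sum s phi + tensor_sum t phi.
Proof. exact: big_cat. Qed.

Lemma tensor_sum_scale k s phi :
  tensor_sum [seq (k *: x.1, x.2) | x <- s] phi = k *: tensor_sum s phi.
Proof.
rewrite /tensor_sum big_map scaler_sumr; apply: eq_bigr => x _.
by rewrite linearZl_LR.
Qed.

Fact is_tensor_submod : submod_closed is_tensor.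
Proof.
split.
  by apply/asboolP; exists [::]; apply/funext => phi; rewrite /tensor_sum big_nil.
move=> k u v /asboolP[s ->] /asboolP[t ->].
apply/asboolP; exists ([seq (k *: x.1, x.2) | x <- s] ++ t).
by apply/funext => phi; rewrite tensor_sum_cat tensor_sum_scale.
Qed.

HB.instance Definition _ := GRing.isSubmodClosed.Build K
  ({bilinear A -> B -> K^o} -> K^o) is_tensor is_tensor_submod.
HB.instance Definition _ := [SubChoice_isSubLmodule of tensor by <:].

Fact tensor_of_subproof s : tensor_sum s \in is_tensor.
Proof. by apply/asboolP; exists s. Qed.

(* [tensor_of [:: (a1, b1); ...; (an, bn)]] is a1 (x) b1 + ... + an (x) bn. *)
Definition tensor_of s : tensor := Tensor (tensor_of_subproof s).

Lemma tensor_eq (u v : tensor) : (forall phi, u phi = v phi) -> u = v.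
Proof. by move=> uv; apply/val_inj/funext. Qed.

Lemma tensor_ofP (u : tensor) : exists s, u = tensor_of s.
Proof.
have /asboolP[s us] := tensorP u.
by exists s; apply: tensor_eq => phi; rewrite us.
Qed.

Lemma tensor_of_cat s t : tensor_of (s ++ t) = tensor_of s + tensor_of t.
Proof. by apply: tensor_eq => phi; rewrite /= tensor_sum_cat. Qed.

Lemma tensor_of_scale k s :
  tensor_of [seq (k *: x.1, x.2) | x <- s] = k *: tensor_of s.
Proof. by apply: tensor_eq => phi; rewrite /= tensor_sum_scale. Qed.

End algebraic_tensor_product.

Section projective_norm.
Variables (R : realType) (A B : normedModType R[i]).

Definition cost (s : seq (A * B)) : R :=
  \sum_(x <- s) rnorm x.1 * rnorm x.2.

Definition proj_norm (u : tensor A B) : R :=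
  inf [set cost s | s in [set s | u = tensor_of s]].

Lemma cost_ge0 s : 0 <= cost s.
Proof. by apply: sumr_ge0 => x _; rewrite mulr_ge0 ?rnorm_ge0. Qed.

Lemma proj_norm_le s : proj_norm (tensor_of s) <= cost s.
Proof.
apply: ge_inf; last by exists s.
by exists 0 => _ [t _ <-]; exact: cost_ge0.
Qed.

Lemma proj_norm_lt (u : tensor A B) M : proj_norm u < M ->
  exists2 s, u = tensor_of s & cost s < M.
Proof.
move=> uM; have [|_ [s us <-] sM] := inf_lt _ uM; last by exists s.
by have [s us] := tensor_ofP u; exists (cost s), s.
Qed.

Fact proj_normD u v : proj_norm (u + v) <= proj_norm u + proj_norm v.
Proof.
apply/ler_addgt0Pr => e e0; have e2 : 0 < e / 2 by rewrite divr_gt0.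
have [|s -> sM] := @proj_norm_lt u (proj_norm u + e / 2); first by rewrite ltrDl.
have [|t -> tM] := @proj_norm_lt v (proj_norm v + e / 2); first by rewrite ltrDl.
rewrite -tensor_of_cat (le_trans (proj_norm_le _))//.
by rewrite /cost big_cat/= (splitr e) addrACA lerD// ltW.
Qed.

Fact proj_normZ (k : R[i]) u : proj_norm (k *: u) = rnorm k * proj_norm u.
Proof.
have H l v : proj_norm (l *: v) <= rnorm l * proj_norm v.
  apply/ler_addgt0Pr => e e0.
  have l1 : 0 < rnorm l + 1 by rewrite ltr_wpDl// rnorm_ge0.
  have [|s vs sM] := @proj_norm_lt v (proj_norm v + e / (rnorm l + 1)).
    by rewrite ltrDl divr_gt0.
  rewrite {1}vs -tensor_of_scale (le_trans (proj_norm_le _))//.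
  have -> : cost [seq (l *: x.1, x.2) | x <- s] = rnorm l * cost s.
    rewrite /cost big_map mulr_sumr; apply: eq_bigr => x _.
    by rewrite rnormZ mulrA.
  rewrite (@le_trans _ _ (rnorm l * (proj_norm v + e / (rnorm l + 1))))//.
    by rewrite ler_wpM2l ?rnorm_ge0// ltW.
  rewrite mulrDr lerD2l mulrCA ger_pMr// ler_pdivrMr// mul1r.
  by rewrite lerDl.
have ge0 v : 0 <= proj_norm v.
  apply: lb_le_inf; first by have [s vs] := tensor_ofP v; exists (cost s), s.
  by move=> _ [t _ <-]; exact: cost_ge0.
apply/eqP; rewrite eq_le H/=.
have [->|k0] := eqVneq k 0; first by rewrite rnorm0 mul0r.
have kp : 0 < rnorm k.
  by rewrite lt_neqAle rnorm_ge0 andbT eq_sym; apply: contra_neq k0; exact: rnorm_eq0.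
rewrite -ler_pdivlMl// -{1}(scalerK k0 u) (le_trans (H _ _))//.
rewrite ler_wpM2r//.
rewrite -(ler_pM2l kp) mulfV ?gt_eqF// -rnormM mulfV//.
by rewrite -lecR rnormE normr1.
Qed.

(* [proj_norm] is a norm; being a seminorm is enough here because [completion]
   identifies the Cauchy sequences that differ by a null sequence. *)
Definition proj_seminorm : seminorm (tensor A B) :=
  Seminorm proj_normD proj_normZ.

Definition ptensor : Type := completion proj_seminorm.

HB.instance Definition _ := CompleteNormedModule.on ptensor.

Fact const_cauchy_subproof (u : tensor A B) :
  (fun _ : nat => u) \in cauchy_pred proj_seminorm.
Proof.
by apply/asboolP => e e0; exists 0%N => m n _ _; rewrite subrr seminorm0.
Qed.

Definition ptensor_of_tensor (u : tensor A B) : ptensor :=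
  cls (CauchySeq (const_cauchy_subproof u)).

Lemma rnorm_ptensor_of_tensor (u : tensor A B) :
  rnorm (ptensor_of_tensor u) = proj_norm u.
Proof. exact: completion_norm_const. Qed.

Definition ptens (a : A) (b : B) : ptensor :=
  ptensor_of_tensor (tensor_of [:: (a, b)]).

End projective_norm.

HB.mixin Record CompleteNormedModule_isBanachAlgebra (K : numFieldType) A
    & CompleteNormedModule K A := {
  amul : A -> A -> A ;
  amulA : associative amul ;
  amulDl : left_distributive amul +%R ;
  amulDr : right_distributive amul +%R ;
  amulZl : forall (k : K) a b, amul (k *: a) b = k *: amul a b ;
  amulZr : forall (k : K) a b, amul a (k *: b) = k *: amul a b ;
  normr_amul : forall a b, `|amul a b| <= `|a| * `|b|
}.

(* The algebra structures of [ssralg] are unital, Banach algebras need not be. *)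
#[short(type="banachAlgType")]
HB.structure Definition BanachAlgebra (K : numFieldType) :=
  {A of CompleteNormedModule K A & CompleteNormedModule_isBanachAlgebra K A}.

Notation "a ** b" := (amul a b) (at level 40, left associativity) : ring_scope.

Definition opposite (A : Type) : Type := A.
Notation "A ^op" := (opposite A) (at level 2, format "A ^op") : type_scope.

Section opposite.
Variables (K : numFieldType) (A : banachAlgType K).

HB.instance Definition _ := CompleteNormedModule.on A^op.

Definition opposite_mul (a b : A^op) : A^op := (b : A) ** (a : A).
Local Notation mul := opposite_mul.

Let mulA : associative mul. Proof. by move=> a b c; rewrite /opposite_mul amulA. Qed.
Let mulDl : left_distributive mul +%R. Proof. by move=> a b c; exact: amulDr. Qed.
Let mulDr : right_distributive mul +%R. Proof. by move=> a b c; exact: amulDl. Qed.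
Let mulZl (k : K) (a b : A^op) : mul (k *: a) b = k *: mul a b.
Proof. exact: amulZr. Qed.
Let mulZr (k : K) (a b : A^op) : mul a (k *: b) = k *: mul a b.
Proof. exact: amulZl. Qed.
Let norm_mul (a b : A^op) : `|mul a b| <= `|a| * `|b|.
Proof. by rewrite mulrC; exact: normr_amul. Qed.

HB.instance Definition _ := CompleteNormedModule_isBanachAlgebra.Build K A^op
  mulA mulDl mulDr mulZl mulZr norm_mul.

End opposite.

Section tensor_algebra.
Variables (R : realType) (A B : banachAlgType R[i]).

Definition tensor_mul_seq (s t : seq (A * B)) : seq (A * B) :=
  [seq (x.1 ** y.1, x.2 ** y.2) | x <- s, y <- t].

Definition tensor_rep (u : tensor A B) : seq (A * B) :=
  projT1 (cid (tensor_ofP u)).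

Lemma tensor_repK u : tensor_of (tensor_rep u) = u.
Proof. by rewrite /tensor_rep; case: cid. Qed.

(* The product extending (a (x) b)(c (x) d) = ac (x) bd bilinearly; it does not
   depend on the chosen representations, see [tensor_mulE]. *)
Definition tensor_mul (u v : tensor A B) : tensor A B :=
  tensor_of (tensor_mul_seq (tensor_rep u) (tensor_rep v)).

Definition rtrans (t : seq (A * B)) (phi : {bilinear A -> B -> R[i]^o})
    (a : A) (b : B) : R[i]^o := \sum_(y <- t) phi (a ** y.1) (b ** y.2).

Definition ltrans (s : seq (A * B)) (phi : {bilinear A -> B -> R[i]^o})
    (a : A) (b : B) : R[i]^o := \sum_(x <- s) phi (x.1 ** a) (x.2 ** b).

Fact rtrans_bilinear t phi : bilinear_for *:%R *:%R (rtrans t phi).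
Proof.
split=> [b k a a'|a k b b']; rewrite /rtrans /= scaler_sumr -big_split/=;
  apply: eq_bigr => y _.
  by rewrite amulDl amulZl linearPl.
by rewrite amulDl amulZl linearPr.
Qed.

Fact ltrans_bilinear s phi : bilinear_for *:%R *:%R (ltrans s phi).
Proof.
split=> [b k a a'|a k b b']; rewrite /ltrans /= scaler_sumr -big_split/=;
  apply: eq_bigr => y _.
  by rewrite amulDr amulZr linearPl.
by rewrite amulDr amulZr linearPr.
Qed.

HB.instance Definition _ t phi := bilinear_isBilinear.Build R[i] A B R[i]^o
  *:%R *:%R (rtrans t phi) (rtrans_bilinear t phi).
HB.instance Definition _ s phi := bilinear_isBilinear.Build R[i] A B R[i]^o
  *:%R *:%R (ltrans s phi) (ltrans_bilinear s phi).

Lemma tensor_sum_mulr s t phi :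
  tensor_sum (tensor_mul_seq s t) phi = tensor_sum s (rtrans t phi).
Proof. by rewrite /tensor_sum /tensor_mul_seq big_allpairs_dep. Qed.

Lemma tensor_sum_mull s t phi :
  tensor_sum (tensor_mul_seq s t) phi = tensor_sum t (ltrans s phi).
Proof.
by rewrite /tensor_sum /tensor_mul_seq big_allpairs_dep exchange_big.
Qed.

Lemma tensor_mulE s t :
  tensor_mul (tensor_of s) (tensor_of t) = tensor_of (tensor_mul_seq s t).
Proof.
have E s' t' : tensor_of s' = tensor_of t' -> forall phi : {bilinear A -> B -> R[i]^o},
    tensor_sum s' phi = tensor_sum t' phi.
  by move=> st phi; have := congr1 (fun u : tensor A B => u phi) st.
apply: tensor_eq => phi; rewrite /= tensor_sum_mulr.
rewrite (E _ _ (tensor_repK (tensor_of s))) -tensor_sum_mulr tensor_sum_mull.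
by rewrite (E _ _ (tensor_repK (tensor_of t))) -tensor_sum_mull.
Qed.

Fact tensor_mulA : associative tensor_mul.
Proof.
move=> u v w; rewrite -(tensor_repK u) -(tensor_repK v) -(tensor_repK w).
rewrite !tensor_mulE; apply: tensor_eq => phi /=.
rewrite !tensor_sum_mulr /tensor_sum; apply: eq_bigr => x _.
rewrite /= /rtrans /tensor_mul_seq big_allpairs_dep; apply: eq_bigr => y _.
by apply: eq_bigr => z _ /=; rewrite !amulA.
Qed.

Fact tensor_mulDl : left_distributive tensor_mul +%R.
Proof.
move=> u v w; rewrite -(tensor_repK u) -(tensor_repK v) -(tensor_repK w).
rewrite -tensor_of_cat !tensor_mulE -tensor_of_cat.
by apply: tensor_eq => phi; rewrite /= !(tensor_sum_cat, tensor_sum_mulr).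
Qed.

Fact tensor_mulDr : right_distributive tensor_mul +%R.
Proof.
move=> u v w; rewrite -(tensor_repK u) -(tensor_repK v) -(tensor_repK w).
rewrite -tensor_of_cat !tensor_mulE -tensor_of_cat.
by apply: tensor_eq => phi; rewrite /= !(tensor_sum_cat, tensor_sum_mull).
Qed.

Fact tensor_mulZl (k : R[i]) u v : tensor_mul (k *: u) v = k *: tensor_mul u v.
Proof.
rewrite -(tensor_repK u) -(tensor_repK v) -tensor_of_scale !tensor_mulE.
rewrite -tensor_of_scale.
by apply: tensor_eq => phi; rewrite /= !(tensor_sum_scale, tensor_sum_mulr).
Qed.

Fact tensor_mulZr (k : R[i]) u v : tensor_mul u (k *: v) = k *: tensor_mul u v.
Proof.
rewrite -(tensor_repK u) -(tensor_repK v) -tensor_of_scale !tensor_mulE.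
rewrite -tensor_of_scale.
by apply: tensor_eq => phi; rewrite /= !(tensor_sum_scale, tensor_sum_mull).
Qed.

Lemma rnorm_amul (K : banachAlgType R[i]) (a b : K) :
  rnorm (a ** b) <= rnorm a * rnorm b.
Proof. by rewrite -lecR rmorphM/= !rnormE normr_amul. Qed.

Fact proj_norm_mul u v :
  proj_norm (tensor_mul u v) <= proj_norm u * proj_norm v.
Proof.
have u0 : 0 <= proj_norm u := seminorm_ge0 (proj_seminorm A B) u.
have v0 : 0 <= proj_norm v := seminorm_ge0 (proj_seminorm A B) v.
apply/ler_addgt0Pr => e e0.
pose S := proj_norm u + proj_norm v + 1.
have S0 : 0 < S by rewrite ltr_wpDl// addr_ge0.
pose d := Num.min 1 (e / S).
have d0 : 0 < d by rewrite lt_min ltr01 divr_gt0.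
have d1 : d <= 1 by rewrite ge_min lexx.
have dS : d * S <= e by rewrite -ler_pdivlMr// ge_min lexx orbT.
have [|s us sM] := @proj_norm_lt _ _ _ u (proj_norm u + d); first by rewrite ltrDl.
have [|t vt tM] := @proj_norm_lt _ _ _ v (proj_norm v + d); first by rewrite ltrDl.
rewrite {1}us {1}vt tensor_mulE (le_trans (proj_norm_le _))//.
rewrite (@le_trans _ _ (cost s * cost t))//.
  rewrite /cost /tensor_mul_seq big_allpairs_dep mulr_suml ler_sum// => x _.
  rewrite mulr_sumr ler_sum// => y _ /=.
  by rewrite mulrACA ler_pM ?rnorm_ge0 ?rnorm_amul.
rewrite (@le_trans _ _ ((proj_norm u + d) * (proj_norm v + d)))//.
  by rewrite ler_pM ?cost_ge0// ltW.
by move: dS; rewrite /S; nra.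
Qed.

Definition ptensor_mul : ptensor A B -> ptensor A B -> ptensor A B :=
  @completion_mul R (tensor A B) (proj_seminorm A B) tensor_mul
    tensor_mulDl tensor_mulDr tensor_mulZl tensor_mulZr proj_norm_mul.

HB.instance Definition _ :=
  CompleteNormedModule_isBanachAlgebra.Build R[i] (ptensor A B)
    (completion_mulA _ _ _ _ tensor_mulA _ : associative ptensor_mul)
    (completion_mulDl _ _ _ _ _) (completion_mulDr _ _ _ _ _)
    (completion_mulZl _ _ _ _ _) (completion_mulZr _ _ _ _ _)
    (completion_norm_mul _ _ _ _ _).

Lemma ptens_mul (a c : A) (b d : B) :
  ptens a b ** ptens c d = ptens (a ** c) (b ** d).
Proof.
rewrite [LHS]completion_mulE; congr cls; apply: cauchy_seq_eq => n.
by rewrite /= tensor_mulE.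
Qed.

End tensor_algebra.

HB.mixin Record CompleteNormedModule_isBanachBimodule (K : numFieldType)
    (A : banachAlgType K) X & CompleteNormedModule K X := {
  lact : A -> X -> X ;
  ract : X -> A -> X ;
  lactDl : forall a b x, lact (a + b) x = lact a x + lact b x ;
  lactDr : forall a x y, lact a (x + y) = lact a x + lact a y ;
  lactZl : forall (k : K) a x, lact (k *: a) x = k *: lact a x ;
  lactZr : forall (k : K) a x, lact a (k *: x) = k *: lact a x ;
  ractDl : forall x y a, ract (x + y) a = ract x a + ract y a ;
  ractDr : forall x a b, ract x (a + b) = ract x a + ract x b ;
  ractZl : forall (k : K) x a, ract (k *: x) a = k *: ract x a ;
  ractZr : forall (k : K) x a, ract x (k *: a) = k *: ract x a ;
  lactA : forall a b x, lact (a ** b) x = lact a (lact b x) ;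
  ractA : forall x a b, ract x (a ** b) = ract (ract x a) b ;
  lractA : forall a x b, ract (lact a x) b = lact a (ract x b) ;
  act_bounded : exists2 C : K, 0 < C &
    forall a x, `|lact a x| <= C * `|a| * `|x| /\
                `|ract x a| <= C * `|a| * `|x|
}.

#[short(type="banachBimodType")]
HB.structure Definition BanachBimodule (K : numFieldType) (A : banachAlgType K) :=
  {X of CompleteNormedModule K X & CompleteNormedModule_isBanachBimodule K A X}.

Section dual_bimodule.
Variables (R : realType) (A : banachAlgType R[i]) (X : banachBimodType A).
Implicit Types (a b : A) (f g : dual X) (x : X).

Lemma rnorm_act_bounded : exists2 C : R, 0 < C & forall a x,
  rnorm (lact a x) <= C * rnorm a * rnorm x /\
  rnorm (ract x a) <= C * rnorm a * rnorm x.
Proof.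
have [C C0 CP] := @act_bounded _ A X.
have CE : C = (complex.Re C)%:C by rewrite RRe_real// gtr0_real.
exists (complex.Re C); first by rewrite -ltr0c -CE.
by move=> a x; rewrite -!lecR !rmorphM/= !rnormE -CE; exact: CP.
Qed.

Fact dual_lact_subproof a f : (fun x => f (ract x a)) \in @continuous_functional R X.
Proof.
apply: continuous_functionalP => [k x y|].
  by rewrite ractDl ractZl linearP.
have [C C0 CP] := rnorm_act_bounded; exists (dual_norm f * (C * rnorm a)) => x.
rewrite (le_trans (le_dual_norm _ _))// -mulrA ler_wpM2l ?dual_norm_ge0//.
by have [] := CP a x.
Qed.

Fact dual_ract_subproof f a : (fun x => f (lact a x)) \in @continuous_functional R X.
Proof.
apply: continuous_functionalP => [k x y|].
  by rewrite lactDr lactZr linearP.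
have [C C0 CP] := rnorm_act_bounded; exists (dual_norm f * (C * rnorm a)) => x.
rewrite (le_trans (le_dual_norm _ _))// -mulrA ler_wpM2l ?dual_norm_ge0//.
by have [] := CP a x.
Qed.

Definition dual_lact a f : dual X := Dual (dual_lact_subproof a f).
Definition dual_ract f a : dual X := Dual (dual_ract_subproof f a).

Let lDl a b f : dual_lact (a + b) f = dual_lact a f + dual_lact b f.
Proof. by apply: dual_eq => x; rewrite dualD/= ractDr linearD. Qed.
Let lDr a f g : dual_lact a (f + g) = dual_lact a f + dual_lact a g.
Proof. exact: dual_eq. Qed.
Let lZl (k : R[i]) a f : dual_lact (k *: a) f = k *: dual_lact a f.
Proof. by apply: dual_eq => x; rewrite dualZ/= ractZr linearZ. Qed.
Let lZr (k : R[i]) a f : dual_lact a (k *: f) = k *: dual_lact a f.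
Proof. exact: dual_eq. Qed.
Let rDl f g a : dual_ract (f + g) a = dual_ract f a + dual_ract g a.
Proof. exact: dual_eq. Qed.
Let rDr f a b : dual_ract f (a + b) = dual_ract f a + dual_ract f b.
Proof. by apply: dual_eq => x; rewrite dualD/= lactDl linearD. Qed.
Let rZl (k : R[i]) f a : dual_ract (k *: f) a = k *: dual_ract f a.
Proof. exact: dual_eq. Qed.
Let rZr (k : R[i]) f a : dual_ract f (k *: a) = k *: dual_ract f a.
Proof. by apply: dual_eq => x; rewrite dualZ/= lactZl linearZ. Qed.
Let lA a b f : dual_lact (a ** b) f = dual_lact a (dual_lact b f).
Proof. by apply: dual_eq => x; rewrite /= ractA. Qed.
Let rA f a b : dual_ract f (a ** b) = dual_ract (dual_ract f a) b.
Proof. by apply: dual_eq => x; rewrite /= lactA. Qed.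
Let lrA a f b : dual_ract (dual_lact a f) b = dual_lact a (dual_ract f b).
Proof. by apply: dual_eq => x; rewrite /= lractA. Qed.
Let bounded : exists2 C : R[i], 0 < C & forall a f,
  `|dual_lact a f| <= C * `|a| * `|f| /\ `|dual_ract f a| <= C * `|a| * `|f|.
Proof.
have [C C0 CP] := rnorm_act_bounded; exists C%:C; first by rewrite ltr0c.
have Cp a : 0 <= C * rnorm a by rewrite mulr_ge0 ?rnorm_ge0 ?ltW.
move=> a f; rewrite -!rnormE -!rmorphM/= !lecR.
rewrite [C * _ * _]mulrC; split; apply: dual_norm_le => x x1;
  rewrite (le_trans (le_dual_norm f _))// ler_wpM2l ?dual_norm_ge0//;
  have [lx rx] := CP a x; [apply: le_trans rx _|apply: le_trans lx _];
  by rewrite ler_piMr.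
Qed.

HB.instance Definition _ :=
  CompleteNormedModule_isBanachBimodule.Build R[i] A (dual X)
    lDl lDr lZl lZr rDl rDr rZl rZr lA rA lrA bounded.

Lemma dual_lactE a f x : (lact a f : dual X) x = f (ract x a).
Proof. by []. Qed.

Lemma dual_ractE f a x : (ract f a : dual X) x = f (lact a x).
Proof. by []. Qed.

End dual_bimodule.

Definition derivation (K : numFieldType) (A : banachAlgType K)
    (X : banachBimodType A) (D : A -> X) : Prop :=
  linear D /\ forall a b, D (a ** b) = lact a (D b) + ract (D a) b.

Definition inner_derivation (K : numFieldType) (A : banachAlgType K)
    (X : banachBimodType A) (D : A -> X) : Prop :=
  exists x : X, forall a, D a = lact a x - ract x a.

Definition amenable (R : realType) (A : banachAlgType R[i]) : Prop :=
  forall (X : banachBimodType A) (D : A -> dual X),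
    continuous D -> derivation D -> inner_derivation D.

Record directed (I : Type) (le : I -> I -> Prop) : Prop := Directed {
  directed_inhabited : inhabited I ;
  directed_refl : forall i, le i i ;
  directed_trans : forall j i k, le i j -> le j k -> le i k ;
  directed_ub : forall i j, exists k, le i k /\ le j k }.

(* Convergence along [tails le] is convergence of a net indexed by [I]. *)
Definition tails (I : Type) (le : I -> I -> Prop) : set_system I :=
  filter_from setT (fun i => [set j | le i j]).

Definition has_bounded_approximate_identity (K : numFieldType)
    (A : banachAlgType K) : Prop :=
  exists (I : Type) (le : I -> I -> Prop) (e : I -> A),
    [/\ directed le,
        exists M : K, forall i, `|e i| <= M,
        forall a, e i ** a @[i --> tails le] --> a &
        forall a, a ** e i @[i --> tails le] --> a].

(* Main.v *)
Require Import Defs.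
From HB Require Import structures.
From mathcomp Require Import all_boot all_order all_algebra.
From mathcomp Require Import all_classical all_reals topology normedtype.
From mathcomp Require Import complex.
From mathcomp Require Import ring.

(** Amenability of a Banach algebra A with a bounded approximate identity is
    equivalent to the existence of a virtual diagonal: a functional mu on the
    bounded bilinear forms on A x A with mu_(a,b) phi(ca, b) = mu_(a,b) phi(a, bc) and
    mu_(a,b) k(abc) = mu_(a,b) k(cab) = k(c) for k in A^*.  Virtual diagonals of A and B
    can be iterated to one of the projective tensor product of A and B, and
    exchanging the two variables gives one of A^op; this yields (i) => (ii) and
    (i) => (iii).

    Conversely let the tensor product U of A and B be amenable and let B have a
    mixed identity e in B^**.  For a derivation D : A -> X^*, the map
    a (x) b |-> D(a) (x) b is a derivation of U into the dual of the bounded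
    forms on B x X^*.  It is implemented by some T, that is,
      h(b) <D(a), x> = T(h(b.) (x) xa) - T(h(.b) (x) ax).
    For h = g(d . c) with g in B^*, averaging over b with e gives
      g(dc) <D(a), x> = T(h (x) xa) - T(h (x) ax),
    so that D is inner as soon as g(dc) <> 0.  For B = A or A^op no Hahn-Banach
    theorem is needed to find g: if D <> 0, take g = <D(.), x>. *)

Set Implicit Arguments.
Unset Strict Implicit.
Unset Printing Implicit Defensive.

Import Order.TTheory GRing.Theory Num.Theory numFieldNormedType.Exports.

Local Open Scope classical_set_scope.
Local Open Scope ring_scope.
Local Open Scope complex_scope.

(** * Bounded operators, bilinear forms and completions *)

Section bounded_operators.
Variable R : realType.

(** Operators and forms are kept as bare functions with an explicit bound, since most of them are
    written as lambda terms. The size [n] on the source is a parameter, so that seminormed spaces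
    are covered as well as normed ones. *)
Definition bounded_operator (V : lmodType R[i]) (W : normedModType R[i])
    (n : V -> R) (M : R) (f : V -> W) : Prop :=
  [/\ 0 <= M, linear f & forall x, rnorm (f x) <= M * n x].

Definition bounded_form (E F : normedModType R[i]) (M : R)
    (phi : E -> F -> R[i]^o) : Prop :=
  [/\ 0 <= M, forall y, linear (phi^~ y), forall x, linear (phi x) &
      forall x y, rnorm (phi x y) <= M * rnorm x * rnorm y].

(** This is what extension by density asks of the target; it is applied both to the scalars [R[i]^o]
    and to Banach spaces. *)
Definition sequentially_complete (W : normedModType R[i]) : Prop :=
  forall u : nat -> W, cauchy_for (@rnorm R W) u ->
  exists l, cvg_for (@rnorm R W) u l.

End bounded_operators.

Notation bounded_linear M f := (bounded_operator (@rnorm _ _) M f).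

Section linear_functions.
Variables (R : realType) (V W : lmodType R[i]).

Lemma linear_add (f : V -> W) : linear f ->
  forall x y, f (x + y) = f x + f y.
Proof. by move=> lf x y; rewrite -[x in LHS]scale1r lf scale1r. Qed.

Lemma linear_zero (f : V -> W) : linear f -> f 0 = 0.
Proof.
by move=> lf; apply: (addrI (f 0)); rewrite -linear_add// !addr0.
Qed.

Lemma linear_scale (f : V -> W) : linear f ->
  forall k x, f (k *: x) = k *: f x.
Proof. by move=> lf k x; rewrite -[k *: x]addr0 lf linear_zero// addr0. Qed.

Lemma linear_sub (f : V -> W) : linear f ->
  forall x y, f (x - y) = f x - f y.
Proof.
by move=> lf x y; rewrite linear_add// -scaleN1r linear_scale// scaleN1r.
Qed.

End linear_functions.

Section bounded_operator_theory.
Variable R : realType.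
Implicit Types (E F G : normedModType R[i]) (M : R).

Lemma dual_bounded_linear E (f : dual E) : bounded_linear (dual_norm f) f.
Proof.
by split; [exact: dual_norm_ge0|exact: dual_linear|exact: le_dual_norm].
Qed.

Lemma bounded_linear_dual E M (f : E -> R[i]^o) :
  bounded_linear M f -> exists2 g : dual E, g =1 f & dual_norm g <= M.
Proof.
move=> [M0 lf fM]; have fP : f \in @continuous_functional R E.
  by apply: continuous_functionalP => //; exists M.
exists (Dual fP) => //; apply: dual_norm_le => x x1 /=.
by rewrite (le_trans (fM x))// ler_piMr.
Qed.

Lemma bounded_operatorP (V : lmodType R[i]) E (n : V -> R) M k N (f g : V -> E) :
  bounded_operator n M f -> bounded_operator n N g ->
  bounded_operator n (rnorm k * M + N) (k *: f + g).
Proof.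
move=> [M0 lf fM] [N0 lg gN].
have fgE z : (k *: f + g) z = k *: f z + g z by [].
split; first by rewrite addr_ge0// mulr_ge0// rnorm_ge0.
  move=> l x y; rewrite !fgE lf lg !scalerDr addrACA !scalerA.
  by rewrite [l * k]mulrC.
move=> x; rewrite fgE (le_trans (rnormD _ _))// mulrDl lerD//.
by rewrite rnormZ -mulrA ler_wpM2l// rnorm_ge0.
Qed.

Lemma bounded_formP E F M k N (f g : E -> F -> R[i]^o) :
  bounded_form M f -> bounded_form N g ->
  bounded_form (rnorm k * M + N) (k *: f + g).
Proof.
move=> [M0 lf lf' fM] [N0 lg lg' gN].
have fgE y z : (k *: f + g) y z = k *: f y z + g y z by [].
split; first by rewrite addr_ge0// mulr_ge0// rnorm_ge0.
- move=> z l x y; rewrite !fgE lf lg !scalerDr addrACA !scalerA.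
  by rewrite [l * k]mulrC.
- move=> z l x y; rewrite !fgE lf' lg' !scalerDr addrACA !scalerA.
  by rewrite [l * k]mulrC.
move=> x y; rewrite fgE (le_trans (rnormD _ _))// !mulrDl lerD//.
by rewrite (@rnormZ R R[i]^o) -!mulrA ler_wpM2l ?rnorm_ge0// mulrA.
Qed.

Lemma bounded_form_curry E F M (phi : E -> F -> R[i]^o) x :
  bounded_form M phi -> bounded_linear (M * rnorm x) (phi x).
Proof. by move=> [M0 _ l2 b]; split=> //; rewrite mulr_ge0 ?rnorm_ge0. Qed.

Lemma bounded_linear_id E : bounded_linear 1 (@id E).
Proof. by split=> // x; rewrite mul1r. Qed.

Lemma bounded_operator_comp E F G M N (f : E -> F) (g : F -> G) :
  bounded_linear M f -> bounded_linear N g -> bounded_linear (N * M) (g \o f).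
Proof.
move=> [M0 lf fM] [N0 lg gN]; split; first exact: mulr_ge0.
  by move=> k x y /=; rewrite lf lg.
move=> x /=; rewrite (le_trans (gN _))// -mulrA ler_wpM2l//.
Qed.

Lemma bounded_form_comp E F (E' F' : normedModType R[i]) M P Q
    (phi : E -> F -> R[i]^o) (f : E' -> E) (g : F' -> F) :
  bounded_form M phi -> bounded_linear P f -> bounded_linear Q g ->
  bounded_form (M * P * Q) (fun x y => phi (f x) (g y)).
Proof.
move=> [M0 l1 l2 pM] [P0 lf fP] [Q0 lg gQ]; split.
- by rewrite !mulr_ge0.
- by move=> y k a b; rewrite lf l1.
- by move=> x k a b; rewrite lg l2.
move=> x y; rewrite (le_trans (pM _ _))//.
have -> : M * P * Q * rnorm x * rnorm y = M * (P * rnorm x) * (Q * rnorm y) by ring.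
by rewrite ler_pM ?mulr_ge0 ?rnorm_ge0// ler_wpM2l.
Qed.

Lemma bounded_form0 E F : bounded_form 0 (0 : E -> F -> R[i]^o).
Proof.
split=> // [y|x|x y]; first by move=> k a b; rewrite /= scaler0 addr0.
  by move=> k a b; rewrite /= scaler0 addr0.
by rewrite rnorm0 !mul0r.
Qed.

Lemma bounded_form_swap E F M (phi : E -> F -> R[i]^o) :
  bounded_form M phi -> bounded_form M (fun x y => phi y x).
Proof. by move=> [M0 l1 l2 pM]; split=> // x y; rewrite mulrAC. Qed.

Lemma bounded_linear_amull (A : banachAlgType R[i]) (c : A) :
  bounded_linear (rnorm c) (fun a => c ** a).
Proof.
split=> [|k a b|a]; first exact: rnorm_ge0.
  by rewrite amulDr amulZr.
exact: rnorm_amul.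
Qed.

Lemma bounded_linear_amulr (A : banachAlgType R[i]) (c : A) :
  bounded_linear (rnorm c) (fun a => a ** c).
Proof.
split=> [|k a b|a]; first exact: rnorm_ge0.
  by rewrite amulDl amulZl.
by rewrite mulrC rnorm_amul.
Qed.

Lemma bounded_form_mul (A : banachAlgType R[i]) M (k : A -> R[i]^o) :
  bounded_linear M k -> bounded_form M (fun a b => k (a ** b)).
Proof.
move=> [M0 lk kM]; split=> //.
- by move=> y l a b /=; rewrite amulDl amulZl lk.
- by move=> y l a b /=; rewrite amulDr amulZr lk.
by move=> a b; rewrite (le_trans (kM _))// -mulrA ler_wpM2l// rnorm_amul.
Qed.

Lemma continuous_linear_bound E F (D : E -> F) : linear D -> continuous D ->
  exists2 M, 0 <= M & forall x, rnorm (D x) <= M * rnorm x.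
Proof.
move=> lD cD; pose L := GRing.isLinear.Build R[i] E F *:%R D lD.
pose D' : {linear E -> F} := HB.pack D L.
have /linear_boundedP := @continuous_linear_bounded _ _ _ 0 D' (cD 0).
(* The constant found is a positive element of [R[i]], hence equal to its real part. *)
move=> /pinfty_ex_gt0[M M0 fM]; exists (complex.Re M).
  by rewrite -ler0c RRe_real ?ltW// gtr0_real.
move=> x; have := fM x.
by rewrite -!rnormE -{1}(RRe_real (gtr0_real M0)) -rmorphM/= lecR.
Qed.

Lemma bounded_linear_continuousP E F (D : E -> F) M : linear D ->
  (forall x, rnorm (D x) <= M * rnorm x) -> continuous D.
Proof.
move=> lD DM; pose L := GRing.isLinear.Build R[i] E F *:%R D lD.
pose D' : {linear E -> F} := HB.pack D L.
apply: (@bounded_linear_continuous _ _ _ D'); apply/linear_boundedP.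
exists M%:C; split; first by rewrite complex_real.
move=> r Mr x; rewrite -!rnormE (le_trans (y := M%:C * (rnorm x)%:C))//.
  by rewrite -rmorphM/= lecR DM.
by rewrite ler_wpM2r ?ler0c ?rnorm_ge0// ltW.
Qed.

Lemma sequentially_complete_banach (W : completeNormedModType R[i]) :
  sequentially_complete W.
Proof.
move=> u uc; have /cvg_ex[l ul] : cvg (u @ \oo).
  apply: cauchy_cvg; apply/cauchyP => e e0.
  have eE : e = (complex.Re e)%:C by rewrite RRe_real// gtr0_real.
  have [|N NP] := uc (complex.Re e); first by rewrite -ltr0c -eE.
  exists (u N); exists N => // n /= Nn.
  by rewrite -ball_normE/= -rnormE eE ltcR NP.
exists l => e e0; have /cvgrPdist_lt/(_ e%:C)[|N _ NP] := ul.
  by rewrite ltr0c.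
by exists N => n Nn; rewrite -ltcR rnormE; apply: NP.
Qed.

End bounded_operator_theory.

(** * Extension by density to a completion *)

Section completion_lift.
Variables (R : realType) (V : lmodType R[i]) (p : seminorm V).

Fact const_cauchy (v : V) : (fun _ : nat => v) \in cauchy_pred p.
Proof.
by apply/asboolP => e e0; exists 0%N => m n _ _; rewrite subrr seminorm0.
Qed.

Definition completion_of (v : V) : completion p := cls (CauchySeq (const_cauchy v)).

Lemma completion_of_linear : linear completion_of.
Proof.
move=> k v w; rewrite /completion_of -cls_scale -clsD; congr cls.
exact: cauchy_seq_eq.
Qed.

Lemma rnorm_completion_of v : rnorm (completion_of v) = p v.
Proof. exact: completion_norm_const. Qed.

Lemma completion_of_dense (x : completion p) e : 0 < e ->
  exists v, rnorm (x - completion_of v) < e.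
Proof.
rewrite -(cls_repr x); set u := repr x => e0.
have e2 : 0 < e / 2 by rewrite divr_gt0.
have [N NP] := cauchy_seq_cauchy u e2; exists (u N).
rewrite -clsB rnorm_completion (@le_lt_trans _ _ (e / 2))//.
  by apply: (@completion_norm_le _ _ _ _ _ N) => n Nn; rewrite ltW// NP.
by rewrite ltr_pdivrMr// ltr_pMr// ltr1n.
Qed.

(** The difference of the two maps is bounded and vanishes on the dense image of [V], so its value
    at [x] is at most a constant times an arbitrarily small distance. *)
Lemma completion_ext (W : normedModType R[i]) M N (f g : completion p -> W) :
  bounded_linear M f -> bounded_linear N g ->
  (forall v, f (completion_of v) = g (completion_of v)) -> f =1 g.
Proof.
move=> fM gN fg x.
have [h0 lh hK] := bounded_operatorP (-1) gN fM.
set h := _ + _ in lh hK; set K := _ + _ in h0 hK.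
have hE y : h y = f y - g y by rewrite -scaleN1r addrC.
have hB y z : h (y - z) = h y - h z.
  by rewrite -[in LHS]scaleN1r addrC lh scaleN1r addrC.
apply/subr0_eq; rewrite -hE.
apply/rnorm_eq0/eqP; rewrite eq_le rnorm_ge0 andbT.
apply/ler_addgt0Pr => e e0; rewrite add0r.
(* Here and below, dividing by [K + 1] avoids a separate case [K = 0]. *)
have h1 : 0 < K + 1 by rewrite ltr_wpDl.
have [|v xv] := @completion_of_dense x (e / (K + 1)).
  by rewrite divr_gt0.
have -> : h x = h (x - completion_of v).
  by rewrite hB [h (completion_of v)]hE fg subrr subr0.
rewrite (le_trans (hK _))//.
rewrite (@le_trans _ _ ((K + 1) * rnorm (x - completion_of v)))//.
  by rewrite ler_wpM2r ?rnorm_ge0// lerDl.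
by rewrite mulrC -ler_pdivlMr// ltW.
Qed.

(** The value at [x] is the limit of [f] along the Cauchy sequence chosen to represent [x], which
    [f] maps to a Cauchy sequence. *)
Lemma completion_lift (W : normedModType R[i]) (M : R) (f : V -> W) :
  sequentially_complete W -> bounded_operator p M f ->
  exists2 F : completion p -> W,
    bounded_linear M F & forall v, F (completion_of v) = f v.
Proof.
move=> Wc [M0 lf fM].
have fB x y : f (x - y) = f x - f y.
  by rewrite -[in LHS]scaleN1r addrC lf scaleN1r addrC.
have /choice[F FP] (x : completion p) :
    exists l, cvg_for (@rnorm R W) (fun n => f (repr x n)) l.
  apply: Wc => e e0.
  have M1 : 0 < M + 1 by rewrite ltr_wpDl.
  have [|N NP] := cauchy_seq_cauchy (repr x) (e := e / (M + 1)).
    by rewrite divr_gt0.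
  exists N => m n Nm Nn; rewrite -fB (le_lt_trans (fM _))//.
  rewrite (@le_lt_trans _ _ ((M + 1) * p (repr x m - repr x n)))//.
    by rewrite ler_wpM2r ?seminorm_ge0// lerDl.
  by rewrite mulrC -ltr_pdivlMr// NP.
(* This estimate yields all properties of [F]: taking [x] in the image of [V] gives the extension
   property, [v = 0] gives the bound, and approximation by vectors of [V] gives linearity. *)
have close x v : rnorm (F x - f v) <= M * rnorm (x - completion_of v).
  apply/ler_addgt0Pr => e e0; have e2 : 0 < e / 2 by rewrite divr_gt0.
  have [N NP] := FP x _ e2.
  have M1 : 0 < M + 1 by rewrite ltr_wpDl.
  have [|K KP] := @completion_norm_lt _ _ p
    (repr x - CauchySeq (const_cauchy v))
    (rnorm (x - completion_of v) + e / 2 / (M + 1)).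
    by rewrite clsB cls_repr ltrDl !divr_gt0.
  pose n := maxn N K; rewrite -(subrK (f (repr x n)) (F x)) -addrA -fB.
  rewrite (le_trans (rnormD _ _))// (splitr e) addrCA lerD//.
    by rewrite ltW// NP// leq_maxl.
  rewrite (le_trans (fM _))//.
  have /ltW/(ler_wpM2l M0)/le_trans := KP n (leq_maxr _ _); apply.
  rewrite mulrDr lerD2l mulrCA ger_pMr ?divr_gt0// ler_pdivrMr// mul1r.
  by rewrite lerDl.
have Fcls v : F (completion_of v) = f v.
  apply/eqP; rewrite -subr_eq0; apply/eqP/rnorm_eq0/eqP.
  by rewrite eq_le rnorm_ge0 andbT (le_trans (close _ _))// subrr rnorm0 mulr0.
have lF : linear F.
  move=> k x y; apply/eqP; rewrite -subr_eq0; apply/eqP/rnorm_eq0/eqP.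
  rewrite eq_le rnorm_ge0 andbT; apply/ler_addgt0Pr => e e0; rewrite add0r.
  pose N := M * (rnorm k + 1 + (rnorm k + 1)) + 1.
  have k1 : 0 <= rnorm k + 1 by rewrite addr_ge0 ?rnorm_ge0.
  have N0 : 0 < N by rewrite ltr_wpDl// mulr_ge0// addr_ge0.
  pose d := e / N; have d0 : 0 < d by rewrite divr_gt0.
  have [v xv] := completion_of_dense x d0.
  have [w yw] := completion_of_dense y d0.
  have -> : F (k *: x + y) - (k *: F x + F y) =
      (F (k *: x + y) - f (k *: v + w)) -
      (k *: (F x - f v) + (F y - f w)).
    by rewrite lf scalerBr addrACA -opprD opprB addrA subrK.
  rewrite (le_trans (rnormD _ _))// rnormN.
  have b1 : rnorm (k *: x + y - completion_of (k *: v + w)) <=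
      (rnorm k + 1) * d.
    rewrite completion_of_linear opprD addrACA -scalerBr.
    rewrite (le_trans (rnormD _ _))// mulrDl mul1r lerD ?(ltW yw)//.
    by rewrite rnormZ ler_wpM2l ?rnorm_ge0// ltW.
  rewrite (@le_trans _ _ (M * ((rnorm k + 1) * d) + (rnorm k * (M * d) + M * d)))//.
    rewrite lerD//; first by rewrite (le_trans (close _ _))// ler_wpM2l.
    rewrite (le_trans (rnormD _ _))// lerD//.
      rewrite rnormZ ler_wpM2l ?rnorm_ge0//.
      by rewrite (le_trans (close _ _))// ler_wpM2l// ltW.
    by rewrite (le_trans (close _ _))// ler_wpM2l// ltW.
  have -> : M * ((rnorm k + 1) * d) + (rnorm k * (M * d) + M * d) =
      M * (rnorm k + 1 + (rnorm k + 1)) * d.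
    by rewrite [rnorm k * (_ * _)]mulrCA -mulrDr -[X in _ + M * (_ + X)]mul1r
      -mulrDl -mulrDr -mulrDl mulrA.
  rewrite /d mulrCA ger_pMr// ler_pdivrMr// mul1r.
  by rewrite lerDl.
exists F => //; split=> // x; have := close x 0.
have -> : f 0 = 0 by rewrite -(subrr 0) fB subrr.
have -> : completion_of 0 = 0.
  by apply: rnorm_eq0; rewrite rnorm_completion_of seminorm0.
by rewrite !subr0.
Qed.

End completion_lift.

(** * Derivations into duals of seminormed bimodules *)

Section seminormed_bimodules.
Variables (R : realType) (A : banachAlgType R[i]) (V : lmodType R[i]).

(** Such a bimodule need be neither complete nor separated: spaces of forms with a quotient seminorm
    are handled in this shape and completed afterwards. *)
Record seminormed_bimodule (p : seminorm V) (C : R)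
    (l : A -> V -> V) (r : V -> A -> V) : Prop := SeminormedBimodule {
  sb_ge0 : 0 <= C ;
  sb_ll : forall v, linear (l^~ v) ;
  sb_lr : forall a, linear (l a) ;
  sb_rl : forall a, linear (r^~ a) ;
  sb_rr : forall v, linear (r v) ;
  sb_lA : forall a b v, l (a ** b) v = l a (l b v) ;
  sb_rA : forall v a b, r v (a ** b) = r (r v a) b ;
  sb_lrA : forall a v b, r (l a v) b = l a (r v b) ;
  sb_lbound : forall a v, p (l a v) <= C * rnorm a * p v ;
  sb_rbound : forall v a, p (r v a) <= C * rnorm a * p v }.

Section completion_bimodule.
Variables (p : seminorm V) (C : R) (l : A -> V -> V) (r : V -> A -> V).
Hypothesis bim : seminormed_bimodule p C l r.

Let X0 := completion p.

Lemma completion_endo (T : V -> V) M : 0 <= M -> linear T ->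
  (forall v, p (T v) <= M * p v) ->
  exists2 F : completion p -> completion p, bounded_linear M F &
    forall v, F (completion_of p v) = completion_of p (T v).
Proof.
move=> M0 lT TM.
apply: (completion_lift (f := fun v => completion_of p (T v))).
  exact: sequentially_complete_banach.
split=> // [k v w|v]; first by rewrite lT completion_of_linear.
by rewrite rnorm_completion_of.
Qed.

Lemma completion_bimodule : exists (X : banachBimodType A) (j : V -> X),
  [/\ linear j, forall v, rnorm (j v) = p v,
      forall a v, lact a (j v) = j (l a v),
      forall a v, ract (j v) a = j (r v a) &
      (forall M N (f g : X -> R[i]^o), bounded_linear M f -> bounded_linear N g ->
          (forall v, f (j v) = g (j v)) -> f =1 g) /\
      (forall M (f : V -> R[i]^o), bounded_operator p M f ->
          exists2 F : X -> R[i]^o, bounded_linear M F & forall v, F (j v) = f v)].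
Proof.
have [C0 ll lr rl rr lA rA lrA lb rb] := bim.
have Ca (a : A) : 0 <= C * rnorm a by rewrite mulr_ge0 ?rnorm_ge0.
have LE a := completion_endo (Ca a) (lr a) (lb a).
have RE a := completion_endo (Ca a) (rl a) (rb^~ a).
pose L a := projT1 (cid2 (LE a)); pose Q a := projT1 (cid2 (RE a)).
have Lb a : bounded_linear (C * rnorm a) (L a) by rewrite /L; case: cid2.
have Qb a : bounded_linear (C * rnorm a) (Q a) by rewrite /Q; case: cid2.
have LP a v : L a (completion_of p v) = completion_of p (l a v).
  by rewrite /L; case: cid2.
have QP a v : Q a (completion_of p v) = completion_of p (r v a).
  by rewrite /Q; case: cid2.
have jl := @completion_of_linear R V p.
pose lact0 (a : A) (x : X0) : X0 := L a x.
pose ract0 (x : X0) (a : A) : X0 := Q a x.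
have Lk k a b (x : X0) : L (k *: a + b) x = k *: L a x + L b x.
  apply: (completion_ext (Lb _) (bounded_operatorP k (Lb a) (Lb b))) => v.
  by rewrite -[RHS]/(k *: L a _ + L b _) !LP -jl ll.
have Qk k a b (x : X0) : Q (k *: a + b) x = k *: Q a x + Q b x.
  apply: (completion_ext (Qb _) (bounded_operatorP k (Qb a) (Qb b))) => v.
  by rewrite -[RHS]/(k *: Q a _ + Q b _) !QP -jl rr.
have lDl a b x : lact0 (a + b) x = lact0 a x + lact0 b x.
  exact: (linear_add (f := L^~ x) (fun k a b => Lk k a b x)).
have lZl (k : R[i]) a x : lact0 (k *: a) x = k *: lact0 a x.
  exact: (linear_scale (f := L^~ x) (fun k a b => Lk k a b x)).
have rDr x a b : ract0 x (a + b) = ract0 x a + ract0 x b.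
  exact: (linear_add (f := Q^~ x) (fun k a b => Qk k a b x)).
have rZr (k : R[i]) x a : ract0 x (k *: a) = k *: ract0 x a.
  exact: (linear_scale (f := Q^~ x) (fun k a b => Qk k a b x)).
have lDr a x y : lact0 a (x + y) = lact0 a x + lact0 a y.
  by have [_ lT _] := Lb a; exact: linear_add lT _ _.
have lZr (k : R[i]) a x : lact0 a (k *: x) = k *: lact0 a x.
  by have [_ lT _] := Lb a; exact: linear_scale lT _ _.
have rDl x y a : ract0 (x + y) a = ract0 x a + ract0 y a.
  by have [_ lT _] := Qb a; exact: linear_add lT _ _.
have rZl (k : R[i]) x a : ract0 (k *: x) a = k *: ract0 x a.
  by have [_ lT _] := Qb a; exact: linear_scale lT _ _.
have lA0 a b x : lact0 (a ** b) x = lact0 a (lact0 b x).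
  apply: (completion_ext (Lb _) (bounded_operator_comp (Lb b) (Lb a))) => v /=.
  by rewrite !LP lA.
have rA0 x a b : ract0 x (a ** b) = ract0 (ract0 x a) b.
  apply: (completion_ext (Qb _) (bounded_operator_comp (Qb a) (Qb b))) => v /=.
  by rewrite !QP rA.
have lrA0 a x b : ract0 (lact0 a x) b = lact0 a (ract0 x b).
  apply: (completion_ext (bounded_operator_comp (Lb a) (Qb b))
    (bounded_operator_comp (Qb b) (Lb a))) => v /=.
  by rewrite LP !QP LP lrA.
have bnd : exists2 K : R[i], 0 < K & forall a x,
    `|lact0 a x| <= K * `|a| * `|x| /\ `|ract0 x a| <= K * `|a| * `|x|.
  (* A Banach bimodule needs a positive constant, whereas [C] may be 0. *)
  exists (C + 1)%:C; first by rewrite ltr0c ltr_wpDl.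
  have H (x : X0) a : C * rnorm a * rnorm x <= (C + 1) * rnorm a * rnorm x.
    by rewrite !ler_wpM2r ?rnorm_ge0// lerDl.
  move=> a x; rewrite -!rnormE -!rmorphM/= !lecR; split.
    by have [_ _ LM] := Lb a; rewrite (le_trans (LM x)).
  by have [_ _ QM] := Qb a; rewrite (le_trans (QM x)).
pose X : banachBimodType A := HB.pack (completion p)
  (CompleteNormedModule_isBanachBimodule.Build R[i] A (completion p)
    lDl lDr lZl lZr rDl rDr rZl rZr lA0 rA0 lrA0 bnd).
exists X, (completion_of p); split.
- exact: jl.
- exact: rnorm_completion_of.
- exact: LP.
- by move=> a v; exact: QP.
split=> [M N f g fM gN|M f fM]; first exact: (@completion_ext R V p R[i]^o M N f g fM gN).
exact: (@completion_lift R V p R[i]^o M f (@complex_complete R) fM).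
Qed.

(* Amenability is tested on derivations into the dual of a seminormed bimodule,
   which need not be complete; the derivation [a, v |-> <D(a), v>] and the
   functional implementing it are given by their values on vectors. *)
Lemma amenable_seminormed (K : R) (D : A -> V -> R[i]^o) :
  amenable A -> 0 <= K -> (forall v, linear (D^~ v)) ->
  (forall a, bounded_operator p (K * rnorm a) (D a)) ->
  (forall a b v, D (a ** b) v = D b (r v a) + D a (l b v)) ->
  exists S : V -> R[i]^o, (exists M, bounded_operator p M S) /\
    forall a v, D a v = S (r v a) - S (l a v).
Proof.
move=> amA K0 Dl Db Dd.
have [X [j [jl jn lE rE [ext lift]]]] := completion_bimodule.
have DE a : exists F : dual X, (forall v, F (j v) = D a v) /\
    dual_norm F <= K * rnorm a.
  have [F Fb Fj] := lift _ _ (Db a).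
  have [G GF GM] := bounded_linear_dual Fb.
  by exists G; split=> // v; rewrite GF.
have /choice[D' D'P] := DE.
have D'j a v : D' a (j v) = D a v by have [->] := D'P a.
have dext (f g : dual X) : (forall v, f (j v) = g (j v)) -> f = g.
  by move=> fg; apply: dual_eq; apply: ext fg; exact: dual_bounded_linear.
have D'l : linear D'.
  move=> k a b; apply: dext => v.
  by rewrite dualD dualZ !D'j Dl.
have D'c : continuous D'.
  apply: (bounded_linear_continuousP (M := K) D'l) => a.
  by rewrite rnorm_dual; have [] := D'P a.
have [|S SP] := amA X D' D'c.
  split=> // a b; apply: dext => v.
  by rewrite dualD dual_lactE dual_ractE lE rE !D'j Dd.
exists (S \o j); split.
  exists (dual_norm S); split=> [|k v w|v]; first exact: dual_norm_ge0.
    by rewrite /= jl dual_linear.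
  by rewrite /= -jn le_dual_norm.
move=> a v; rewrite -D'j SP dualB dual_lactE dual_ractE.
by rewrite lE rE.
Qed.

End completion_bimodule.
End seminormed_bimodules.

(** * Mixed identities and virtual diagonals *)

Section means.
Variable R : realType.
Implicit Types E F : normedModType R[i].

(* A mean is only specified on its domain: [P M f] says that [f] belongs to the
   domain and has bound [M]. *)
Definition bounded_mean (W : lmodType R[i]) (P : R -> W -> Prop) (K : R)
    (mu : W -> R[i]^o) : Prop :=
  [/\ 0 <= K,
      forall k f g M N, P M f -> P N g -> mu (k *: f + g) = k *: mu f + mu g &
      forall M f, P M f -> rnorm (mu f) <= K * M].

Lemma bounded_mean0 (W : lmodType R[i]) (P : R -> W -> Prop) K mu :
  P 0 0 -> bounded_mean P K mu -> mu 0 = 0.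
Proof.
move=> P0 [K0 _ muK]; apply/rnorm_eq0/eqP; rewrite eq_le rnorm_ge0 andbT.
by rewrite (le_trans (muK _ _ P0))// mulr0.
Qed.

Lemma bounded_meanD (W : lmodType R[i]) (P : R -> W -> Prop) K mu f g M N :
  bounded_mean P K mu -> P M f -> P N g -> mu (f + g) = mu f + mu g.
Proof.
by move=> [_ mul _] fM gN; rewrite -[f in LHS]scale1r (mul _ _ _ _ _ fM gN) scale1r.
Qed.

(** The device that turns means into functionals: it produces those that implement a derivation from
    a virtual diagonal, and the inner integral of every iterated mean. *)
Lemma bounded_mean_family (W : lmodType R[i]) (P : R -> W -> Prop) K
    (mu : W -> R[i]^o) E N (Phi : E -> W) : bounded_mean P K mu ->
  linear Phi -> 0 <= N -> (forall y, P (N * rnorm y) (Phi y)) ->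
  bounded_linear (K * N) (fun y => mu (Phi y)).
Proof.
move=> [K0 mul muK] lPhi N0 PPhi; split; first exact: mulr_ge0.
  by move=> k x y /=; rewrite lPhi (mul _ _ _ _ _ (PPhi x) (PPhi y)).
by move=> x; rewrite -mulrA muK.
Qed.

(** These are the elements of the bidual of E and of the bidual of the projective tensor product of
    E and F, whose dual is the space of bounded bilinear forms. *)
Definition dual_mean E := @bounded_mean (E -> R[i]^o)
  (fun M f => bounded_linear M f).
Definition form_mean E F := @bounded_mean (E -> F -> R[i]^o)
  (@bounded_form R E F).

(** This is a tensor product of the two means; the variable in [F] is integrated first, which fixes
    one of the two possible orders. *)
Lemma iterated_mean E F K L
    (e : (E -> R[i]^o) -> R[i]^o) (f : (F -> R[i]^o) -> R[i]^o) :
  dual_mean K e -> dual_mean L f ->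
  form_mean (L * K) (fun phi => e (fun x => f (phi x))).
Proof.
move=> em fm; have [K0 el eb] := em; have [L0 fl fb] := fm.
have P M (phi : E -> F -> R[i]^o) :
    bounded_form M phi -> bounded_linear (L * M) (fun x => f (phi x)).
  move=> pM; have [M0 l1 _ _] := pM; apply: bounded_mean_family fm _ M0 _.
    by move=> k x y; apply/funext => z; rewrite l1.
  by move=> x; exact: bounded_form_curry.
split=> [|k g h M N gM hN|M g gM]; first exact: mulr_ge0.
  rewrite -(el _ _ _ _ _ (P _ _ gM) (P _ _ hN)); congr (e _).
  apply/funext => x; rewrite -[RHS]/(k *: f (g x) + f (h x)).
  by rewrite -(fl _ _ _ _ _ (bounded_form_curry x gM) (bounded_form_curry x hN)).
by rewrite mulrAC mulrC eb//; exact: P.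
Qed.

(** An element of the bidual of A that is a right identity for the first Arens product and a left
    identity for the second. *)
Definition mixed_identity (A : banachAlgType R[i]) (K : R)
    (e : (A -> R[i]^o) -> R[i]^o) : Prop :=
  dual_mean K e /\ forall M (k : A -> R[i]^o) c, bounded_linear M k ->
    e (fun a => k (a ** c)) = k c /\ e (fun a => k (c ** a)) = k c.

(** Johnson's virtual diagonal M, in the bidual of the projective tensor product of A with itself:
    c.M = M.c, and the bidual of the product map sends M to a mixed identity. *)
Definition virtual_diagonal (A : banachAlgType R[i]) (K : R)
    (mu : (A -> A -> R[i]^o) -> R[i]^o) : Prop :=
  [/\ form_mean K mu,
      forall M phi c, bounded_form M phi ->
        mu (fun a b => phi (c ** a) b) = mu (fun a b => phi a (b ** c)) &
      forall M (k : A -> R[i]^o) c, bounded_linear M k ->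
        mu (fun a b => k (a ** b ** c)) = k c /\
        mu (fun a b => k (c ** (a ** b))) = k c].

(** The image of [U] on the compact segment from -M to M has a cluster point r. A neighbourhood of r
    or its complement belongs to the ultrafilter, and clustering excludes the complement. *)
Lemma ultrafilter_lim_real (I : Type) (U : set_system I) (h : I -> R) M :
  UltraFilter U -> (forall i, `|h i| <= M) ->
  exists r, forall e, 0 < e -> U [set i | `|r - h i| < e].
Proof.
move=> UU hM; have PU : ProperFilter (h @ U) by exact: fmap_proper_filter.
have [|r [_ rc]] := @segment_compact R (- M) M (h @ U) PU.
  apply: (@filterS _ U _ setT); last exact: filterT.
  by move=> i _ /=; rewrite in_itv /= -ler_norml hM.
exists r => e e0.
have [//|Un] := in_ultra_setVsetC [set i | `|r - h i| < e] UU.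
have [||_ [[i ni <-] ei]] := rc (h @` (~` [set i | `|r - h i| < e])) (ball r e).
- by apply: (@filterS _ U) Un => i ni; exists i.
- exact: nbhsx_ballx.
by case: ni; exact: ei.
Qed.

Lemma ultrafilter_lim (I : Type) (U : set_system I) (h : I -> R[i]^o) M :
  UltraFilter U -> (forall i, rnorm (h i) <= M) ->
  exists z : R[i]^o, forall e, 0 < e -> U [set i | rnorm (z - h i) < e].
Proof.
move=> UU hM.
have [|a aU] := ultrafilter_lim_real (h := fun i => complex.Re (h i)) (M := M) UU.
  by move=> i; rewrite (le_trans (rnorm_Re _)).
have [|b bU] := ultrafilter_lim_real (h := fun i => complex.Im (h i)) (M := M) UU.
  by move=> i; rewrite (le_trans (rnorm_Im _)).
exists (a +i* b) => e e0; have e2 : 0 < e / 2 by rewrite divr_gt0.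
apply: filterS (filterI (aU _ e2) (bU _ e2)) => i [/= ai bi].
rewrite (le_lt_trans (rnorm_le _))// [ltRHS]splitr ltrD//.
  by move: ai; case: (h i).
by move: bi; case: (h i).
Qed.

(** The mixed identity is a weak-star cluster point of the net in the bidual: the limit of k(e_i)
    along an ultrafilter finer than the tails. *)
Lemma mixed_identity_of_bai (A : banachAlgType R[i]) :
  has_bounded_approximate_identity A -> exists K e, @mixed_identity A K e.
Proof.
move=> [I [le [e [dle [K0 eK] el er]]]].
have [i0] := directed_inhabited dle.
(* The bound is given in [R[i]]; it lies above a norm, the index set being inhabited, and is
   therefore a nonnegative real. *)
have K0E : K0 = (complex.Re K0)%:C.
  by rewrite RRe_real// ger0_real// (le_trans _ (eK i0)).
set K := complex.Re K0 in K0E.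
have {}eK i : rnorm (e i) <= K by rewrite -lecR rnormE -K0E.
have PF : ProperFilter (tails le).
  apply: filter_from_proper; last first.
    by move=> i _; exists i; exact: directed_refl dle i.
  apply: filter_from_filter; first by exists i0.
  move=> i j _ _; have [k [ik jk]] := directed_ub dle i j.
  by exists k => // m km; split; apply: (directed_trans dle) km.
have [U [UU tU]] := ultraFilterLemma PF.
have cvU (x : A) (u : I -> A) : u i @[i --> tails le] --> x ->
    forall d, 0 < d -> U [set i | rnorm (x - u i) < d].
  move=> /cvgrPdist_lt ux d d0; apply: tU.
  have := ux d%:C; rewrite ltr0c => /(_ d0).
  by apply: filterS => i /=; rewrite -rnormE ltcR.
pose islim (k : A -> R[i]^o) (z : R[i]^o) :=
  forall d, 0 < d -> U [set i | rnorm (z - k (e i)) < d].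
have lim_uniq k z w : islim k z -> islim k w -> z = w.
  move=> kz kw; apply/subr0_eq/rnorm_eq0/eqP; rewrite eq_le rnorm_ge0 andbT.
  apply/ler_addgt0Pr => d d0; rewrite add0r; have d2 : 0 < d / 2 by rewrite divr_gt0.
  have [i [/= zi wi]] := filter_ex (filterI (kz _ d2) (kw _ d2)).
  rewrite -(subrK (k (e i)) z) -addrA (le_trans (rnormD _ _))// (splitr d).
  by rewrite lerD ?(ltW zi)// -opprB rnormN ltW.
have lim_ex M k : bounded_linear M k -> exists z, islim k z.
  move=> [M0 lk kM]; apply: (ultrafilter_lim (M := M * K)) => i.
  by rewrite (le_trans (kM _))// ler_wpM2l.
(* The default 0 is the value at functions without a limit; every bounded functional has one. *)
pose E (k : A -> R[i]^o) : R[i]^o := xget 0 [set z | islim k z].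
have EP M k : bounded_linear M k -> islim k (E k).
  by move=> /lim_ex[z zk]; exact: (xgetI (P := [set z | islim k z]) 0 zk).
have K_ge0 : 0 <= K by apply: le_trans (eK i0); exact: rnorm_ge0.
exists K, E; split.
  split=> // [k f g M N fM gN|M f fM].
    apply: (lim_uniq (k *: f + g)); first exact: (EP _ _ (bounded_operatorP k fM gN)).
    move=> d d0; have k1 : 0 < rnorm k + 1 by rewrite ltr_wpDl// rnorm_ge0.
    have d2 : 0 < d / 2 by rewrite divr_gt0.
    have d3 : 0 < d / 2 / (rnorm k + 1) by rewrite divr_gt0.
    apply: filterS (filterI (EP _ _ fM _ d3) (EP _ _ gN _ d2)) => i [/= fi gi].
    have -> : k *: E f + E g - (k *: f + g) (e i) =
        k *: (E f - f (e i)) + (E g - g (e i)).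
      by rewrite scalerBr addrACA opprD.
    rewrite (le_lt_trans (rnormD _ _))// [ltRHS]splitr ler_ltD//.
    rewrite (@rnormZ R R[i]^o) (@le_trans _ _ ((rnorm k + 1) * rnorm (E f - f (e i))))//.
      by rewrite ler_wpM2r ?rnorm_ge0// lerDl.
    by rewrite mulrC -ler_pdivlMr// ltW.
  apply/ler_addgt0Pr => d d0; have [i /= fi] := filter_ex (EP _ _ fM _ d0).
  have [M0 _ fb] := fM.
  rewrite -(subrK (f (e i)) (E f)) addrC (le_trans (rnormD _ _))// lerD ?(ltW fi)//.
  by rewrite mulrC (le_trans (fb _))// ler_wpM2l.
(* Taking for [g] the right or the left multiplication by [c] gives the two identities. *)
have main M k (g : A -> A) N c : bounded_linear M k -> bounded_linear N g ->
    g (e i) @[i --> tails le] --> c -> E (fun a => k (g a)) = k c.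
  move=> kM gN ge; apply: (lim_uniq (fun a => k (g a))).
    by apply: EP (bounded_operator_comp gN kM).
  have [M0 lk kb] := kM; move=> d d0; have M1 : 0 < M + 1 by rewrite ltr_wpDl.
  have d1 : 0 < d / (M + 1) by rewrite divr_gt0.
  apply: filterS (cvU _ _ ge _ d1) => i /= ci.
  rewrite -(linear_sub lk) (le_lt_trans (kb _))//.
  rewrite (@le_lt_trans _ _ ((M + 1) * rnorm (c - g (e i))))//.
    by rewrite ler_wpM2r ?rnorm_ge0// lerDl.
  by rewrite mulrC -ltr_pdivlMr.
move=> M k c kM; split.
  apply: (main _ _ (fun a => a ** c) (rnorm c) c kM) => //.
  split; [exact: rnorm_ge0|by move=> l a b; rewrite amulDl amulZl|].
  by move=> a; rewrite mulrC rnorm_amul.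
apply: (main _ _ (fun a => c ** a) (rnorm c) c kM) => //.
split; [exact: rnorm_ge0|by move=> l a b; rewrite amulDr amulZr|].
by move=> a; rewrite rnorm_amul.
Qed.

End means.

(** * Amenability from a virtual diagonal *)

Section virtual_diagonal_amenable.
Variables (R : realType) (A : banachAlgType R[i]).

(** The functional is the image of [mu] under the bidual of the product map. *)
Lemma virtual_diagonal_mixed_identity K mu : @virtual_diagonal R A K mu ->
  mixed_identity K (fun k => mu (fun a b => k (a ** b))).
Proof.
move=> [[K0 mul muK] _ mupi]; split; last first.
  move=> M k c kM; exact: mupi kM.
split=> // [k f g M N fM gN|M f fM]; last exact: muK (bounded_form_mul fM).
exact: (mul k _ _ _ _ (bounded_form_mul fM) (bounded_form_mul gN)).
Qed.

(** The functional S(x) = mu_(u,v) <D(v), xu> implements D up to a remainder D', because x need not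
    be of the form yz. The remainder vanishes on X.A, and a second functional S', built from the
    mixed identity of [mu], absorbs it. *)
Lemma virtual_diagonal_amenable K mu : @virtual_diagonal R A K mu -> amenable A.
Proof.
move=> vd X D cD [lD dD].
have [mum mucomm mupi] := vd; have [K0 mul muK] := mum.
pose e (k : A -> R[i]^o) := mu (fun a b => k (a ** b)).
have [em eid] : mixed_identity K e := virtual_diagonal_mixed_identity vd.
have eE k : e k = mu (fun a b => k (a ** b)) by [].
clearbody e.
have [KD KD0 DK] := continuous_linear_bound lD cD.
have [C C0 CP] := @rnorm_act_bounded R A X.
have Db w x : rnorm (D w x) <= KD * rnorm w * rnorm x.
  rewrite (le_trans (le_dual_norm _ _))// ler_wpM2r ?rnorm_ge0//.
  exact: DK.
have Dl (x : X) : linear (fun w => D w x).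
  by move=> k a b; rewrite lD dualD dualZ.
have DE a b x : D (a ** b) x = D b (ract x a) + D a (lact b x).
  by rewrite dD dualD dual_lactE dual_ractE.
have ractl (x : X) : linear (ract x) by move=> k a b; rewrite ractDr ractZr.
have ractx a : linear (fun x : X => ract x a) by move=> k x y; rewrite ractDl ractZl.
have lactl (x : X) : linear (lact^~ x) by move=> k a b; rewrite lactDl lactZl.
have lactx a : linear (@lact _ A X a) by move=> k x y; rewrite lactDr lactZr.
pose Phi (x : X) (u v : A) : R[i]^o := D v (ract x u).
have Phib x : bounded_form (KD * C * rnorm x) (Phi x).
  split.
  - by rewrite !mulr_ge0 ?rnorm_ge0// ltW.
  - by move=> v k a b; rewrite /Phi ractl dual_linear.
  - by move=> u k a b; rewrite /Phi Dl.
  move=> u v; rewrite (le_trans (Db _ _))//.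
  have -> : KD * C * rnorm x * rnorm u * rnorm v =
    KD * rnorm v * (C * rnorm u * rnorm x).
    by ring.
  by rewrite ler_wpM2l ?mulr_ge0 ?rnorm_ge0//; have [] := CP u x.
have Phil : linear Phi.
  by move=> k x y; apply/funext => u; apply/funext => v; rewrite /Phi ractx dual_linear.
have [|S SE _] := bounded_linear_dual
    (bounded_mean_family mum Phil (N := KD * C) _ Phib).
  by rewrite mulr_ge0// ltW.
have Dfb w x : bounded_linear (KD * rnorm w * C * rnorm x) (fun u => D w (ract x u)).
  split.
  - by rewrite !mulr_ge0 ?rnorm_ge0// ltW.
  - by move=> k a b; rewrite ractl dual_linear.
  move=> u; rewrite (le_trans (Db _ _))// -!mulrA ler_wpM2l//.
  rewrite ler_wpM2l ?rnorm_ge0//.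
  by have [_] := CP u x; rewrite -mulrA [rnorm u * _]mulrC.
(* Moving w across [mu] turns <D(v), xwu> into <D(vw), xu>; the derivation rule splits this into
   <D(w), xuv>, whose mean is the term in [e], and <D(v), wxu>, whose mean is S(wx). *)
have SD w x : S (ract x w) = e (fun u => D w (ract x u)) + S (lact w x).
  rewrite !SE eE.
  have -> : mu (Phi (ract x w)) = mu (fun u v => Phi x (w ** u) v).
    by congr (mu _); apply/funext => u; apply/funext => v; rewrite /Phi ractA.
  rewrite (mucomm _ _ _ (Phib x)).
  rewrite -(bounded_meanD mum (bounded_form_mul (Dfb w x)) (Phib (lact w x))).
  congr (mu _); apply/funext => u; apply/funext => v.
  by rewrite -[RHS]/(_ u v + _ u v) /Phi DE ractA lractA.
pose D' w (x : X) : R[i]^o := D w x - (S (ract x w) - S (lact w x)).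
have D'E w x : D' w x = D w x - e (fun u => D w (ract x u)).
  by rewrite /D' SD addrK.
(* On X.A the mixed identity evaluates the mean in [D'E]: e_u <D(w), xzu> = <D(w), xz>. *)
have D'0 w x z : D' w (ract x z) = 0.
  rewrite D'E.
  have -> : e (fun u => D w (ract (ract x z) u)) = D w (ract x z).
    rewrite -[RHS](eid _ _ z (Dfb w x)).2; congr (e _).
    by apply/funext => u; rewrite ractA.
  by rewrite subrr.
(* D' is again a derivation, and [D'0] kills one of the two terms of its product rule. *)
have D'M a b x : D' (a ** b) x = D' a (lact b x).
  have -> : D' (a ** b) x = D' b (ract x a) + D' a (lact b x).
    rewrite /D' DE ractA lactA lractA addrACA -opprD; congr (_ - _).
    by rewrite addrA subrK.
  by rewrite D'0 add0r.
have subZ (k a b c d : R[i]^o) :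
    k *: a + b - (k *: c + d) = k *: (a - c) + (b - d).
  by rewrite scalerBr addrACA opprD.
have D'l x : linear (fun w => D' w x).
  move=> k a b; rewrite /D' Dl ractl lactl !dual_linear.
  by rewrite !subZ.
have D'x w : linear (D' w).
  move=> k x y; rewrite /D' ractx lactx !dual_linear.
  by rewrite !subZ.
pose N := KD + (dual_norm S * C + dual_norm S * C).
have SC0 : 0 <= dual_norm S * C by rewrite mulr_ge0 ?dual_norm_ge0// ltW.
have N0 : 0 <= N by rewrite !addr_ge0.
have D'b w x : rnorm (D' w x) <= N * rnorm x * rnorm w.
  rewrite mulrAC -mulrA !mulrDl !mulrA (le_trans (rnormD _ _))// rnormN lerD//.
  by rewrite (le_trans (rnormD _ _))// rnormN lerD// (le_trans (le_dual_norm _ _))//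
    -!mulrA ler_wpM2l ?dual_norm_ge0// mulrA; have [] := CP w x.
have D'bl x : bounded_linear (N * rnorm x) (fun w => D' w x).
  by split=> //; rewrite mulr_ge0 ?rnorm_ge0.
(* With S'(x) = e_u <D'(u), x>, the rule [D'M] gives S'(wx) = <D'(w), x>, and [D'0] gives S'(xw) =
   0. Hence S' implements -D', and S - S' implements D. *)
have [||S' S'E _] := bounded_linear_dual (bounded_mean_family em
    (Phi := fun x w => D' w x) (N := N) _ _ D'bl) => //.
  by move=> k x y; apply/funext => w; rewrite D'x.
have S'l w x : S' (lact w x) = D' w x.
  rewrite S'E -(eid _ _ w (D'bl x)).1.
  by congr (e _); apply/funext => u; rewrite D'M.
have S'r w x : S' (ract x w) = 0.
  rewrite S'E.
  have -> : (fun u => D' u (ract x w)) = 0 by apply/funext => u; rewrite D'0.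
  apply: bounded_mean0 em.
  split=> // [k y z|y]; first by rewrite /= scaler0 addr0.
  by rewrite rnorm0 mul0r.
exists (S - S') => w; apply: dual_eq => x.
rewrite dualB dual_lactE dual_ractE !dualB S'r S'l subr0 /D'.
by rewrite !opprB addrA addrCA [X in _ + X - _]addrC subrK addrK.
Qed.

End virtual_diagonal_amenable.

(** * Bounded bilinear forms and their quotient seminorms *)

Section forms.
Variables (R : realType) (E F : normedModType R[i]).

Definition is_form : {pred E -> F -> R[i]^o} :=
  fun phi => `[< exists M, bounded_form M phi >].

Record bform := BForm { form_fun :> E -> F -> R[i]^o ; formP : form_fun \in is_form }.

HB.instance Definition _ := [isSub for form_fun].
HB.instance Definition _ := [Choice of bform by <:].

Fact is_form_submod : submod_closed is_form.
Proof.
split; first by apply/asboolP; exists 0; exact: bounded_form0.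
move=> k f g /asboolP[M fM] /asboolP[N gN].
by apply/asboolP; exists (rnorm k * M + N); exact: bounded_formP.
Qed.

HB.instance Definition _ := GRing.isSubmodClosed.Build R[i]
  (E -> F -> R[i]^o) is_form is_form_submod.
HB.instance Definition _ := [SubChoice_isSubLmodule of bform by <:].

Lemma form_bounded (phi : bform) : exists M, bounded_form M phi.
Proof. exact/asboolP/formP. Qed.

Lemma form_eq (phi psi : bform) : (forall x y, phi x y = psi x y) -> phi = psi.
Proof.
by move=> e; apply/val_inj/funext => x; apply/funext => y; exact: e.
Qed.

Lemma formE k (phi psi : bform) x y : (k *: phi + psi) x y = k *: phi x y + psi x y.
Proof. by []. Qed.

(** Functions that are not bounded forms are sent to the default 0, so evaluating the result calls
    for a bound, through [to_formE]. *)
Definition to_form (phi : E -> F -> R[i]^o) : bform := insubd 0 phi.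

Lemma to_formE M phi : bounded_form M phi -> to_form phi = phi :> (E -> F -> R[i]^o).
Proof.
by move=> phiM; rewrite /to_form -[LHS]/(val _) insubdK//; apply/asboolP; exists M.
Qed.

Lemma to_formP k M N (f g : E -> F -> R[i]^o) : bounded_form M f ->
  bounded_form N g -> to_form (k *: f + g) = k *: to_form f + to_form g.
Proof.
move=> fM gN; apply: form_eq => x y; rewrite formE (to_formE fM) (to_formE gN).
by rewrite (to_formE (bounded_formP k fM gN)).
Qed.

Section gauge.
Variable N : set (E -> F -> R[i]^o).
Hypothesis N0 : N 0.
Hypothesis NP : forall k f g, N f -> N g -> N (k *: f + g).

Let NZ k f : N f -> N (k *: f).
Proof. by move=> Nf; rewrite -[_ *: _]addr0; exact: NP. Qed.

(** The quotient seminorm modulo [N]. It is used with [N] the set of forms k(ab), and with [N]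
    reduced to 0, where it is the usual norm of a bounded form. *)
Definition gauge (phi : bform) : R :=
  inf [set M | exists2 nu, N nu & bounded_form M ((phi : E -> F -> R[i]^o) - nu)].

Lemma gauge_le M nu (phi : bform) : N nu ->
  bounded_form M ((phi : E -> F -> R[i]^o) - nu) -> gauge phi <= M.
Proof.
move=> Nnu pM; apply: ge_inf; last by exists nu.
by exists 0 => m [nu' _ []].
Qed.

(** A nearly optimal [M] replaces the infimum. Estimates against the gauge go through this form,
    which only mentions admissible bounds. *)
Lemma le_mul_gauge c C (phi : bform) : 0 <= C ->
  (forall M nu, N nu -> bounded_form M ((phi : E -> F -> R[i]^o) - nu) ->
     c <= C * M) -> c <= C * gauge phi.
Proof.
move=> C0 H; apply/ler_addgt0Pr => e e0.
have C1 : 0 < C + 1 by rewrite ltr_wpDl.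
have [||M [nu Nnu pM] Mlt] := @inf_lt _
   [set M | exists2 nu, N nu & bounded_form M ((phi : E -> F -> R[i]^o) - nu)]
   (gauge phi + e / (C + 1)).
- have [M pM] := form_bounded phi; exists M, 0 => //.
  by rewrite subr0.
- by rewrite /gauge ltrDl divr_gt0.
rewrite (le_trans (H _ _ Nnu pM))//.
have /ltW/(ler_wpM2l C0)/le_trans := Mlt; apply.
rewrite mulrDr lerD2l mulrCA ger_pMr// ler_pdivrMr// mul1r.
by rewrite lerDl.
Qed.

Fact gaugeD phi psi : gauge (phi + psi) <= gauge phi + gauge psi.
Proof.
rewrite -lerBlDr -[leRHS]mul1r; apply: le_mul_gauge => // M nu Nnu pM.
rewrite mul1r lerBlDr -lerBlDl -[leRHS]mul1r.
apply: le_mul_gauge => // M' nu' Nnu' pM'; rewrite mul1r lerBlDl.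
apply: (gauge_le (nu := 1 *: nu + nu')); first exact: NP.
have := bounded_formP 1 pM pM'.
rewrite {1}/rnorm normr1 mul1r !scale1r; congr (bounded_form _ _).
by rewrite opprD addrACA.
Qed.

Fact gaugeZ (k : R[i]) phi : gauge (k *: phi) = rnorm k * gauge phi.
Proof.
have H l psi : gauge (l *: psi) <= rnorm l * gauge psi.
  apply: le_mul_gauge => [|M nu Nnu pM]; first exact: rnorm_ge0.
  apply: (gauge_le (nu := l *: nu)); first exact: NZ.
  have := bounded_formP l pM (bounded_form0 E F); rewrite !addr0.
  by congr (bounded_form _ _); rewrite scalerBr.
apply/eqP; rewrite eq_le H/=.
have [->|k0] := eqVneq k 0.
  rewrite rnorm0 mul0r -[leRHS]mul1r; apply: le_mul_gauge => // M nu _ [M0 *].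
  by rewrite mul1r.
have kp : 0 < rnorm k.
  by rewrite lt_neqAle rnorm_ge0 andbT eq_sym; apply: contra_neq k0; exact: rnorm_eq0.
have gauge_ge0 : 0 <= gauge (k *: phi).
  by rewrite -[leRHS]mul1r; apply: le_mul_gauge => // M nu _ [M0 *]; rewrite mul1r.
(* The reverse inequality is [H] for the inverse of [k]. *)
rewrite -ler_pdivlMl// -{1}(scalerK k0 phi) (le_trans (H _ _))//.
rewrite ler_wpM2r// -(ler_pM2l kp) mulfV ?gt_eqF// -rnormM mulfV//.
by rewrite -lecR rnormE normr1.
Qed.

Definition gauge_seminorm : seminorm bform := Seminorm gaugeD gaugeZ.

Lemma gauge_to_form M phi : bounded_form M phi -> gauge (to_form phi) <= M.
Proof.
by move=> pM; apply: (gauge_le (nu := 0)) => //; rewrite subr0 (to_formE pM).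
Qed.

Lemma gauge_eq0 (phi : bform) : N phi -> gauge phi <= 0.
Proof.
by move=> Np; apply: (gauge_le Np); rewrite subrr; exact: bounded_form0.
Qed.

End gauge.
End forms.

(** * A virtual diagonal from amenability *)

Section amenable_virtual_diagonal.
Variables (R : realType) (A : banachAlgType R[i]).

(** Put M0 = e (x) e. The derivation c |-> c.M0 - M0.c takes its values in the annihilator of the
    forms k(ab), which is the dual of the quotient of all bounded forms by these. Amenability
    implements it by some S in that annihilator, and M0 - S is the virtual diagonal. *)
Lemma amenable_virtual_diagonal K e : @mixed_identity R A K e -> amenable A ->
  exists L mu, @virtual_diagonal R A L mu.
Proof.
move=> [em eid] amA; have eem := iterated_mean em em.
set ee := fun phi => _ in eem.
pose r (phi : bform A A) c := to_form (fun a b => phi (c ** a) b).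
pose l c (phi : bform A A) := to_form (fun a b => phi a (b ** c)).
have rb M (phi : A -> A -> R[i]^o) c : bounded_form M phi ->
    bounded_form (rnorm c * M) (fun a b => phi (c ** a) b).
  move=> pM; rewrite mulrC -[X in bounded_form X]mulr1.
  exact: bounded_form_comp pM (bounded_linear_amull c) (bounded_linear_id A).
have lb M (phi : A -> A -> R[i]^o) c : bounded_form M phi ->
    bounded_form (rnorm c * M) (fun a b => phi a (b ** c)).
  move=> pM; rewrite mulrC -[X in bounded_form (X * _)]mulr1.
  exact: bounded_form_comp pM (bounded_linear_id A) (bounded_linear_amulr c).
have rE phi c a b : r phi c a b = phi (c ** a) b.
  by have [M pM] := form_bounded phi; rewrite /r (to_formE (rb _ _ c pM)).
have lE c phi a b : l c phi a b = phi a (b ** c).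
  by have [M pM] := form_bounded phi; rewrite /l (to_formE (lb _ _ c pM)).
(* Functionals vanishing on [N] are those killed by the bidual of the product map. *)
pose N : set (A -> A -> R[i]^o) :=
  [set phi | exists M k, bounded_linear M k /\ phi = fun a b => k (a ** b)].
have N0 : N 0.
  exists 0, 0; split=> //; split=> // [k x y|x]; first by rewrite /= scaler0 addr0.
  by rewrite rnorm0 mul0r.
have NP k f g : N f -> N g -> N (k *: f + g).
  move=> [M [f' [fM ->]]] [M' [g' [gM ->]]].
  by exists (rnorm k * M + M'), (k *: f' + g'); split=> //; exact: bounded_operatorP.
have Nr phi c : N phi -> N (fun a b => phi (c ** a) b).
  move=> [M [k [kM ->]]]; exists (M * rnorm c), (fun a => k (c ** a)); split.
    exact: bounded_operator_comp (bounded_linear_amull c) kM.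
  by apply/funext => a; apply/funext => b; rewrite amulA.
have Nl phi c : N phi -> N (fun a b => phi a (b ** c)).
  move=> [M [k [kM ->]]]; exists (M * rnorm c), (fun a => k (a ** c)); split.
    exact: bounded_operator_comp (bounded_linear_amulr c) kM.
  by apply/funext => a; apply/funext => b; rewrite amulA.
pose p := gauge_seminorm N0 NP.
have bim : seminormed_bimodule p 1 l r.
  split=> //.
  - move=> v k a b; apply: form_eq => x y; rewrite formE !lE.
    have [M [_ _ + _]] := form_bounded v.
    by rewrite amulDr amulZr => ->.
  - by move=> a k v w; apply: form_eq => x y; rewrite !(formE, lE).
  - by move=> a k v w; apply: form_eq => x y; rewrite !(formE, rE).
  - move=> v k a b; apply: form_eq => x y; rewrite formE !rE.
    have [M [_ + _ _]] := form_bounded v.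
    by rewrite amulDl amulZl => ->.
  - by move=> a b v; apply: form_eq => x y; rewrite !lE amulA.
  - by move=> v a b; apply: form_eq => x y; rewrite !rE amulA.
  - by move=> a v b; apply: form_eq => x y; rewrite rE !lE rE.
  - move=> c v; rewrite mul1r; apply: (le_mul_gauge N0) => [|M nu Nnu pM].
      exact: rnorm_ge0.
    apply: (gauge_le (Nl _ c Nnu)); have := lb _ _ c pM; congr (bounded_form _ _).
    by apply/funext => x; apply/funext => y; rewrite -[RHS]/(_ x y - _) lE.
  - move=> v c; rewrite mul1r; apply: (le_mul_gauge N0) => [|M nu Nnu pM].
      exact: rnorm_ge0.
    apply: (gauge_le (Nr _ c Nnu)); have := rb _ _ c pM; congr (bounded_form _ _).
    by apply/funext => x; apply/funext => y; rewrite -[RHS]/(_ x y - _) rE.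
pose D c (phi : bform A A) : R[i]^o := ee (r phi c) - ee (l c phi).
have [L0 eel eeb] := eem.
(* Two applications of the mixed identity give [ee] the unit rules of a virtual diagonal; the
   commutation rule is what remains to be arranged. *)
have eeK M k c : bounded_linear M k ->
    ee (fun a b => k (a ** b ** c)) = k c /\
    ee (fun a b => k (c ** (a ** b))) = k c.
  move=> kM; split; rewrite /ee.
    rewrite -[RHS](eid _ _ c kM).1; congr (e _); apply/funext => a.
    have kaM := bounded_operator_comp (bounded_linear_amull a) kM.
    rewrite -[RHS](eid _ _ c kaM).1; congr (e _); apply/funext => b /=.
    by rewrite amulA.
  rewrite -[RHS](eid _ _ c kM).2; congr (e _); apply/funext => a.
  rewrite -[RHS](eid _ _ (c ** a) kM).2; congr (e _); apply/funext => b.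
  by rewrite amulA.
have eeD M phi c : bounded_form M phi -> rnorm
    (ee (fun a b => phi (c ** a) b) - ee (fun a b => phi a (b ** c))) <=
    (K * K + K * K) * rnorm c * M.
  move=> pM; rewrite (le_trans (rnormD _ _))// rnormN -mulrA mulrDl.
  by rewrite lerD// eeb//; [exact: rb|exact: lb].
have ee_sub M M' phi psi : bounded_form M phi -> bounded_form M' psi ->
    ee (phi - psi) = ee phi - ee psi.
  by move=> pM qM; rewrite addrC -scaleN1r (eel _ _ _ _ _ qM pM) scaleN1r addrC.
have DE c phi : D c phi =
    ee (fun a b => phi (c ** a) b) - ee (fun a b => phi a (b ** c)).
  by rewrite /D; congr (ee _ - ee _); apply/funext => a; apply/funext => b.
have Db c : bounded_operator p ((K * K + K * K) * rnorm c) (D c).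
  have KK0 : 0 <= (K * K + K * K) * rnorm c.
    by rewrite mulr_ge0 ?rnorm_ge0// addr_ge0.
  split=> // [k v w|v].
    have [M vM] := form_bounded v; have [M' wM] := form_bounded w.
    rewrite !DE (eel k _ _ _ _ (rb _ _ c vM) (rb _ _ c wM)).
    rewrite (eel k _ _ _ _ (lb _ _ c vM) (lb _ _ c wM)).
    by rewrite scalerBr addrACA opprD.
  (* Subtracting an element k(ab) of [N] from the form lowers both means by k(c), so their
     difference is unaffected and its bound passes to the gauge. *)
  apply: (le_mul_gauge N0) => // M _ [M' [k [kM ->]]] vM.
  have [Mv vMv] := form_bounded v.
  have := eeD _ _ c vM; congr (rnorm _ <= _).
  have nuM := bounded_form_mul kM.
  have /= -> := ee_sub _ _ _ _ (rb _ _ c vMv) (rb _ _ c nuM).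
  have /= -> := ee_sub _ _ _ _ (lb _ _ c vMv) (lb _ _ c nuM).
  have -> : ee (fun a b => k (c ** a ** b)) = k c.
    by rewrite -(eeK _ _ c kM).2; congr (ee _); apply/funext => a;
      apply/funext => b; rewrite amulA.
  have -> : ee (fun a b => k (a ** (b ** c))) = k c.
    by rewrite -(eeK _ _ c kM).1; congr (ee _); apply/funext => a;
      apply/funext => b; rewrite amulA.
  by rewrite DE opprB addrA subrK.
have [||| a b v|S [[M [M0 lS SM]] SP]] :=
    @amenable_seminormed _ _ _ p 1 l r bim (K * K + K * K) D amA.
- by rewrite addr_ge0.
- move=> v k a b; have [M vM] := form_bounded v; have [_ l1 l2 _] := vM.
  rewrite !DE.
  have -> : (fun x y => v ((k *: a + b) ** x) y) =
      k *: (fun x y => v (a ** x) y) + (fun x y => v (b ** x) y).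
    by apply/funext => x; apply/funext => y; rewrite amulDl amulZl l1.
  have -> : (fun x y => v x (y ** (k *: a + b))) =
      k *: (fun x y => v x (y ** a)) + (fun x y => v x (y ** b)).
    by apply/funext => x; apply/funext => y; rewrite amulDr amulZr l2.
  rewrite (eel k _ _ _ _ (rb _ _ a vM) (rb _ _ b vM)).
  rewrite (eel k _ _ _ _ (lb _ _ a vM) (lb _ _ b vM)).
  by rewrite scalerBr addrACA opprD.
- exact: Db.
- rewrite !DE.
  have -> : (fun x y => r v a (b ** x) y) = (fun x y => v (a ** b ** x) y).
    by apply/funext => x; apply/funext => y; rewrite rE amulA.
  have -> : (fun x y => r v a x (y ** b)) = (fun x y => l b v (a ** x) y).
    by apply/funext => x; apply/funext => y; rewrite rE lE.
  have -> : (fun x y => l b v x (y ** a)) = (fun x y => v x (y ** (a ** b))).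
    by apply/funext => x; apply/funext => y; rewrite lE amulA.
  by rewrite addrA subrK.
(* [S] is bounded for a seminorm that vanishes on [N], so subtracting it from [ee] does not disturb
   the unit rules. *)
have S0 (phi : bform A A) : N phi -> S phi = 0.
  move=> Np; apply/rnorm_eq0/eqP; rewrite eq_le rnorm_ge0 andbT.
  by rewrite (le_trans (SM _))// mulr_ge0_le0// gauge_eq0.
have SN phi M' : bounded_form M' phi -> N phi -> S (to_form phi) = 0.
  by move=> pM Np; apply: S0; rewrite (to_formE pM).
exists (K * K + M), (fun phi => ee phi - S (to_form phi)); split.
- split=> [|k f g M1 M2 fM gM|M1 f fM]; first exact: addr_ge0.
    rewrite (eel _ _ _ _ _ fM gM) (to_formP _ fM gM) lS.
    by rewrite scalerBr addrACA opprD.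
  rewrite mulrDl (le_trans (rnormD _ _))// lerD ?eeb// rnormN.
  by rewrite (le_trans (SM _))// ler_wpM2l// (gauge_to_form N0 fM).
- move=> M1 phi c pM; apply/subr0_eq.
  have := SP c (to_form phi); rewrite DE (to_formE pM).
  have -> : r (to_form phi) c = to_form (fun a b => phi (c ** a) b).
    by rewrite /r (to_formE pM).
  have -> : l c (to_form phi) = to_form (fun a b => phi a (b ** c)).
    by rewrite /l (to_formE pM).
  by move=> SE; rewrite opprD opprK addrACA SE [- S _ + _]addrC addrA subrK subrr.
move=> M1 k c kM; have [e1 e2] := eeK _ _ c kM.
have f1 := bounded_form_mul (bounded_operator_comp (bounded_linear_amulr c) kM).
have f2 := bounded_form_mul (bounded_operator_comp (bounded_linear_amull c) kM).
split.
  rewrite e1 (SN _ _ f1) ?subr0//.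
  by exists (M1 * rnorm c), (fun a => k (a ** c)); split=> //;
    exact: bounded_operator_comp (bounded_linear_amulr c) kM.
rewrite e2 (SN _ _ f2) ?subr0//.
by exists (M1 * rnorm c), (fun a => k (c ** a)); split=> //;
  exact: bounded_operator_comp (bounded_linear_amull c) kM.
Qed.

End amenable_virtual_diagonal.

(** * Projective tensor products *)

Section projective_tensor.
Variables (R : realType) (A B : normedModType R[i]).

Lemma ptensl (b : B) : linear (fun a : A => ptens a b).
Proof.
move=> k a a'; rewrite /ptens /ptensor_of_tensor -cls_scale -clsD; congr cls.
apply: cauchy_seq_eq => n; apply: tensor_eq => phi.
by rewrite -[RHS]/(k *: tensor_sum _ phi + tensor_sum _ phi) /=
  /tensor_sum !big_seq1 /= linearPl.
Qed.

Lemma ptensr (a : A) : linear (fun b : B => ptens a b).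
Proof.
move=> k b b'; rewrite /ptens /ptensor_of_tensor -cls_scale -clsD; congr cls.
apply: cauchy_seq_eq => n; apply: tensor_eq => phi.
by rewrite -[RHS]/(k *: tensor_sum _ phi + tensor_sum _ phi) /=
  /tensor_sum !big_seq1 /= linearPr.
Qed.

Lemma rnorm_ptens (a : A) (b : B) : rnorm (ptens a b) <= rnorm a * rnorm b.
Proof.
rewrite rnorm_ptensor_of_tensor (le_trans (proj_norm_le _))//.
by rewrite /cost big_seq1.
Qed.

Lemma bounded_linear_ptensr (a : A) :
  bounded_linear (rnorm a) (fun b : B => ptens a b).
Proof.
by split; [exact: rnorm_ge0|exact: ptensr|move=> b; exact: rnorm_ptens].
Qed.

Lemma bounded_linear_ptensl (b : B) :
  bounded_linear (rnorm b) (fun a : A => ptens a b).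
Proof.
split; [exact: rnorm_ge0|exact: ptensl|move=> a; rewrite mulrC].
exact: rnorm_ptens.
Qed.

(** Elementary tensors span the algebraic tensor product, whose image is dense. *)
Lemma ptensor_ext (W : normedModType R[i]) M N (f g : ptensor A B -> W) :
  bounded_linear M f -> bounded_linear N g ->
  (forall a b, f (ptens a b) = g (ptens a b)) -> f =1 g.
Proof.
move=> fM gN fg; apply: (completion_ext fM gN) => u.
have [_ lf _] := fM; have [_ lg _] := gN.
have [s ->] := tensor_ofP u; set j := completion_of _.
have jl : linear j by exact: completion_of_linear.
elim: s => [|[a b] s IHs].
  have -> : tensor_of [::] = 0 :> tensor A B.
    by apply: tensor_eq => phi; rewrite /= /tensor_sum big_nil.
  by rewrite (linear_zero jl) !linear_zero.
rewrite -cat1s tensor_of_cat (linear_add jl) !linear_add// IHs; congr (_ + _).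
have -> : j (tensor_of [:: (a, b)]) = ptens a b.
  by congr cls; exact: cauchy_seq_eq.
exact: fg.
Qed.

(** An algebraic tensor is a functional on bilinear forms, so the linear map attached to [psi] is
    evaluation at [psi]. Any representation [s] bounds it by [M * cost s], hence [M] times the
    projective norm bounds it, and it extends by density. *)
Lemma ptensor_lift_ex M (psi : A -> B -> R[i]^o) : bounded_form M psi ->
  exists2 F : ptensor A B -> R[i]^o, bounded_linear M F &
    forall a b, F (ptens a b) = psi a b.
Proof.
move=> [M0 l1 l2 pM].
have psi2 : bilinear_for *:%R *:%R psi.
  by split=> [b k a a'|a k b b'] /=; rewrite ?l1 ?l2.
pose Psi : {bilinear A -> B -> R[i]^o} := HB.pack psi
  (bilinear_isBilinear.Build R[i] A B R[i]^o *:%R *:%R psi psi2).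
have [F FM FE] : exists2 F : ptensor A B -> R[i]^o, bounded_linear M F &
    forall u, F (completion_of (proj_seminorm A B) u) = u Psi.
  apply: (completion_lift (f := fun u : tensor A B => u Psi)).
    exact: complex_complete.
  split=> // u; apply/ler_addgt0Pr => e e0.
  have M1 : 0 < M + 1 by rewrite ltr_wpDl.
  have [|s us sM] := @proj_norm_lt _ _ _ u (proj_norm u + e / (M + 1)).
    by rewrite ltrDl divr_gt0.
  rewrite [in X in rnorm X]us /= /tensor_sum (@le_trans _ _ (M * cost s))//.
    rewrite /cost mulr_sumr; elim: s {us sM} => [|x s IHs].
      by rewrite !big_nil rnorm0.
    rewrite !big_cons (le_trans (rnormD _ _))// lerD//.
    by rewrite mulrA; exact: pM.
  have /ltW/(ler_wpM2l M0)/le_trans := sM; apply.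
  rewrite mulrDr lerD2l mulrCA ger_pMr// ler_pdivrMr// mul1r.
  by rewrite lerDl.
exists F => // a b.
have -> : ptens a b = completion_of (proj_seminorm A B) (tensor_of [:: (a, b)]).
  by congr cls; exact: cauchy_seq_eq.
by rewrite FE /= /tensor_sum big_seq1.
Qed.

(** A total function of [psi], so that later definitions need not carry bounds. The lift of a
    bounded form is unique by [ptensor_ext]; the default is 0. *)
Definition ptensor_lift (psi : A -> B -> R[i]^o) : ptensor A B -> R[i]^o :=
  xget 0 [set F | exists2 M, bounded_linear M F & forall a b, F (ptens a b) = psi a b].

Lemma ptensor_liftP M psi : bounded_form M psi ->
  bounded_linear M (ptensor_lift psi) /\
  forall a b, ptensor_lift psi (ptens a b) = psi a b.
Proof.
move=> /ptensor_lift_ex[F FM FE].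
set S := [set G | exists2 N, bounded_linear N G &
  forall a b, G (ptens a b) = psi a b].
have [N LN LE] : S (ptensor_lift psi) by apply: (@xgetI _ _ S F); exists M.
split=> //; have -> // : ptensor_lift psi = F.
by apply/funext; apply: (ptensor_ext LN FM) => a b; rewrite LE FE.
Qed.

Lemma ptensor_lift_linear M N k psi psi' u : bounded_form M psi ->
  bounded_form N psi' ->
  ptensor_lift (k *: psi + psi') u = k *: ptensor_lift psi u + ptensor_lift psi' u.
Proof.
move=> pM pN; have [lM lE] := ptensor_liftP pM; have [lN lE'] := ptensor_liftP pN.
have [sM sE] := ptensor_liftP (bounded_formP k pM pN).
apply: (ptensor_ext sM (bounded_operatorP k lM lN)) => a b.
by rewrite sE -[RHS]/(k *: ptensor_lift psi _ + ptensor_lift psi' _) lE lE'.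
Qed.

End projective_tensor.

(** * Virtual diagonals of opposite algebras and of tensor products *)

Section virtual_diagonals.
Variable R : realType.

(** Once the variables are swapped, reversing the product exchanges the two sides of the commutation
    rule and the two unit rules. *)
Lemma virtual_diagonal_op (A : banachAlgType R[i]) K mu :
  @virtual_diagonal R A K mu ->
  @virtual_diagonal R A^op K (fun phi => mu (fun a b => phi b a)).
Proof.
move=> [[K0 mul muK] mucomm mupi].
have sw M (phi : A^op -> A^op -> R[i]^o) : bounded_form M phi ->
  @bounded_form R A A M (fun a b => phi b a) := @bounded_form_swap R A A M phi.
split.
- split=> // [k f g M N fM gN|M f fM]; last by apply: muK; exact: sw.
  by rewrite -(mul _ _ _ _ _ (sw _ _ fM) (sw _ _ gN)).
- by move=> M phi c pM; rewrite -(mucomm _ _ c (sw _ _ pM)).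
by move=> M k c kM; have [e1 e2] := mupi M k c kM; split.
Qed.

Lemma mixed_identity_op (A : banachAlgType R[i]) K e :
  @mixed_identity R A K e -> @mixed_identity R A^op K e.
Proof.
by move=> [em eid]; split=> // M k c kM; have [e1 e2] := eid M k c kM; split.
Qed.

Section tensor.
Variables (A B : banachAlgType R[i]) (K L : R).
Variables (mu : (A -> A -> R[i]^o) -> R[i]^o) (nu : (B -> B -> R[i]^o) -> R[i]^o).

(** The version of [bounded_mean_family] with two parameters: it makes the inner integral over B a
    bounded form on A x A, to which [mu] applies. *)
Lemma form_mean_family M (Psi : A -> A -> B -> B -> R[i]^o) : form_mean L nu ->
  0 <= M -> (forall a a', bounded_form (M * rnorm a * rnorm a') (Psi a a')) ->
  (forall a', linear (Psi^~ a')) -> (forall a, linear (Psi a)) ->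
  bounded_form (L * M) (fun a a' => nu (Psi a a')).
Proof.
move=> num M0 PM l1 l2; have [L0 _ nuL] := num; split.
- exact: mulr_ge0.
- move=> a'.
  have [] // := bounded_mean_family num (l1 a') (N := M * rnorm a').
    by rewrite mulr_ge0 ?rnorm_ge0.
  by move=> a; rewrite mulrAC.
- move=> a.
  have [] // := bounded_mean_family num (l2 a) (N := M * rnorm a).
  by rewrite mulr_ge0 ?rnorm_ge0.
by move=> a a'; rewrite -!mulrA nuL// mulrA.
Qed.

(** Both sides of each rule are bounded linear in the element w of the tensor product, so w may be
    taken to be c (x) d. Then the rule of [nu] for d is used inside and that of [mu] for c
    outside. *)
Lemma virtual_diagonal_tensor : virtual_diagonal K mu -> virtual_diagonal L nu ->
  @virtual_diagonal R (ptensor A B) (K * L) (fun Phi => mu (fun a a' =>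
    nu (fun b b' => Phi (ptens a b) (ptens a' b')))).
Proof.
move=> [mum mucomm mupi] [num nucomm nupi].
have [K0 mul muK] := mum; have [L0 nul nuL] := num.
set U := ptensor A B; set om := fun Phi => _.
pose Psi (Phi : U -> U -> R[i]^o) a a' b b' := Phi (ptens a b) (ptens a' b').
have PsiM M Phi a a' : bounded_form M Phi ->
    bounded_form (M * rnorm a * rnorm a') (Psi Phi a a').
  move=> PM; exact: (bounded_form_comp PM (bounded_linear_ptensr B a)
    (bounded_linear_ptensr B a')).
have PsiF M Phi : bounded_form M Phi ->
    bounded_form (L * M) (fun a a' => nu (Psi Phi a a')).
  move=> PM; have [M0 l1 l2 _] := PM; apply: form_mean_family => //.
  - by move=> a a'; exact: PsiM.
  - move=> a' k x y; apply/funext => b; apply/funext => b'.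
    by rewrite /Psi ptensl l1.
  - move=> a k x y; apply/funext => b; apply/funext => b'.
    by rewrite /Psi ptensl l2.
have omm : form_mean (K * L) om.
  split=> [|k f g M N fM gN|M f fM]; first exact: mulr_ge0.
    rewrite -(mul _ _ _ _ _ (PsiF _ _ fM) (PsiF _ _ gN)); congr (mu _).
    apply/funext => a; apply/funext => a'.
    rewrite -[RHS]/(k *: nu (Psi f a a') + nu (Psi g a a')).
    by rewrite -(nul _ _ _ _ _ (PsiM _ _ a a' fM) (PsiM _ _ a a' gN)).
  by rewrite -mulrA; apply: muK; exact: PsiF.
split=> //.
- move=> M Phi w PM; have [M0 l1 l2 Pb] := PM.
  have lM (v : U) : bounded_form (M * rnorm v) (fun x y => Phi (v ** x) y).
    rewrite -[_ * _]mulr1.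
    exact: bounded_form_comp PM (bounded_linear_amull v) (bounded_linear_id _).
  have rM (v : U) : bounded_form (M * rnorm v) (fun x y => Phi x (y ** v)).
    rewrite -[M]mulr1.
    exact: bounded_form_comp PM (bounded_linear_id _) (bounded_linear_amulr v).
  have lB := bounded_mean_family omm (Phi := fun v x y => Phi (v ** x) y) _ M0 lM.
  have rB := bounded_mean_family omm (Phi := fun v x y => Phi x (y ** v)) _ M0 rM.
  apply: (ptensor_ext (lB _) (rB _)) => [k v v'|k v v'|c d].
  - by apply/funext => x; apply/funext => y; rewrite amulDl amulZl l1.
  - by apply/funext => x; apply/funext => y; rewrite amulDr amulZr l2.
  (* In [H] the element d has already been moved to the right by [nu]; being a bounded form in a and
     a', it allows [mu] to move c. *)
  pose H a a' := nu (fun b b' => Phi (ptens a b) (ptens a' (b' ** d))).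
  have HM : bounded_form (L * (M * rnorm d)) H.
    apply: form_mean_family => //.
    - by rewrite mulr_ge0 ?rnorm_ge0.
    - move=> a a'; have -> : M * rnorm d * rnorm a * rnorm a' =
        M * rnorm a * (rnorm a' * rnorm d) by ring.
      apply: (bounded_form_comp PM (bounded_linear_ptensr B a)).
      exact: (bounded_operator_comp (bounded_linear_amulr d)
        (bounded_linear_ptensr B a')).
    - by move=> a' k x y; apply/funext => b; apply/funext => b'; rewrite ptensl l1.
    - by move=> a k x y; apply/funext => b; apply/funext => b'; rewrite ptensl l2.
  transitivity (mu (fun a a' => H (c ** a) a')).
    congr (mu _); apply/funext => a; apply/funext => a'.
    rewrite /H -(nucomm _ _ d (PsiM _ _ (c ** a) a' PM)); congr (nu _).
    by apply/funext => b; apply/funext => b'; rewrite ptens_mul.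
  rewrite (mucomm _ _ _ HM); congr (mu _); apply/funext => a; apply/funext => a'.
  by congr (nu _); apply/funext => b; apply/funext => b'; rewrite ptens_mul.
move=> M k w kM; have [M0 lk kb] := kM; have kkM := bounded_form_mul kM.
have kl (v : U) : bounded_form (M * rnorm v) (fun x y => k (x ** y ** v)).
  exact: bounded_form_mul (bounded_operator_comp (bounded_linear_amulr v) kM).
have kr (v : U) : bounded_form (M * rnorm v) (fun x y => k (v ** (x ** y))).
  exact: bounded_form_mul (bounded_operator_comp (bounded_linear_amull v) kM).
have kd (d : B) : bounded_linear (M * rnorm d) (fun a : A => k (ptens a d)).
  exact: bounded_operator_comp (bounded_linear_ptensl A d) kM.
have kc (c : A) : bounded_linear (M * rnorm c) (fun b : B => k (ptens c b)).
  exact: bounded_operator_comp (bounded_linear_ptensr B c) kM.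
have lB := bounded_mean_family omm (Phi := fun v x y => k (x ** y ** v)) _ M0 kl.
have rB := bounded_mean_family omm (Phi := fun v x y => k (v ** (x ** y))) _ M0 kr.
split.
  apply: (ptensor_ext (lB _) kM) => [l v v'|c d].
    by apply/funext => x; apply/funext => y; rewrite amulDr amulZr lk.
  rewrite -[RHS](mupi _ _ c (kd d)).1; congr (mu _).
  apply/funext => a; apply/funext => a'.
  rewrite -[RHS](nupi _ _ d (kc _)).1; congr (nu _).
  by apply/funext => b; apply/funext => b'; rewrite !ptens_mul.
apply: (ptensor_ext (rB _) kM) => [l v v'|c d].
  by apply/funext => x; apply/funext => y; rewrite amulDl amulZl lk.
rewrite -[RHS](mupi _ _ c (kd d)).2; congr (mu _).
apply/funext => a; apply/funext => a'.
rewrite -[RHS](nupi _ _ d (kc _)).2; congr (nu _).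
by apply/funext => b; apply/funext => b'; rewrite !ptens_mul.
Qed.

End tensor.
End virtual_diagonals.

(** * Descent of amenability to a tensor factor *)

Section tensor_factor.
Variables (R : realType) (A B : banachAlgType R[i]).
Notation U := (ptensor A B).

Section operator_bimodule.
Variables (X : banachBimodType A) (D : A -> dual X).
Hypotheses (lD : linear D) (cD : continuous D).
Hypothesis dD : forall a b, D (a ** b) = lact a (D b) + ract (D a) b.

Notation V := (bform B (dual X)).

(** The actions are first written as bare functions, because their bounds must be known before
    [to_form] can package them faithfully. *)
Definition form_lact_raw (u : U) (phi : B -> dual X -> R[i]^o) 
    (y : B) (xi : dual X) : R[i]^o :=
  ptensor_lift (fun a b => phi (y ** b) (ract xi a)) u.

Definition form_ract_raw (phi : B -> dual X -> R[i]^o) (u : U) 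
    (y : B) (xi : dual X) : R[i]^o :=
  ptensor_lift (fun a b => phi (b ** y) (lact a xi)) u.

Definition form_lact (u : U) (phi : V) : V := to_form (form_lact_raw u phi).
Definition form_ract (phi : V) (u : U) : V := to_form (form_ract_raw phi u).

(* The derivation a (x) b |-> D(a) (x) b into the dual of the space of bounded
   forms on B x X^*, the predual bimodule being the forms themselves. *)
Definition form_der (u : U) (phi : V) : R[i]^o := ptensor_lift (fun a b => phi b (D a)) u.

Let act_bound := @rnorm_act_bounded R A (dual X).
Let C := projT1 (cid2 act_bound).
Let C0 : 0 <= C. Proof. by rewrite /C; case: cid2 => c c0 cP; exact: ltW. Qed.

Let ractb (xi : dual X) : bounded_linear (C * rnorm xi) (fun a : A => ract xi a).
Proof.
rewrite /C; case: cid2 => c c0 cP /=; split.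
- by rewrite mulr_ge0 ?rnorm_ge0// ltW.
- by move=> k a b; rewrite ractDr ractZr.
by move=> a; have [_] := cP a xi; rewrite mulrAC.
Qed.

Let lactb (xi : dual X) : bounded_linear (C * rnorm xi) (fun a : A => lact a xi).
Proof.
rewrite /C; case: cid2 => c c0 cP /=; split.
- by rewrite mulr_ge0 ?rnorm_ge0// ltW.
- by move=> k a b; rewrite lactDl lactZl.
by move=> a; have [] := cP a xi; rewrite mulrAC.
Qed.

Let lact_form M (phi : B -> dual X -> R[i]^o) y xi : bounded_form M phi ->
  bounded_form (M * rnorm y * (C * rnorm xi))
    (fun (a : A) (b : B) => phi (y ** b) (ract xi a)).
Proof.
move=> pM; apply: bounded_form_swap.
exact: bounded_form_comp pM (bounded_linear_amull y) (ractb xi).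
Qed.

Let ract_form M (phi : B -> dual X -> R[i]^o) y xi : bounded_form M phi ->
  bounded_form (M * rnorm y * (C * rnorm xi))
    (fun (a : A) (b : B) => phi (b ** y) (lact a xi)).
Proof.
move=> pM; apply: bounded_form_swap.
exact: bounded_form_comp pM (bounded_linear_amulr y) (lactb xi).
Qed.

Lemma form_lact_raw_bounded M (phi : B -> dual X -> R[i]^o) u : bounded_form M phi ->
  bounded_form (C * rnorm u * M) (form_lact_raw u phi).
Proof.
move=> pM; have [M0 l1 l2 pb] := pM; split.
- by rewrite !mulr_ge0 ?rnorm_ge0.
- move=> xi k y y'.
  rewrite -(ptensor_lift_linear _ _ (lact_form y xi pM) (lact_form y' xi pM)).
  congr (ptensor_lift _ _); apply/funext => a; apply/funext => b.
  by rewrite amulDl amulZl l1.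
- move=> y k xi xi'.
  rewrite -(ptensor_lift_linear _ _ (lact_form y xi pM) (lact_form y xi' pM)).
  congr (ptensor_lift _ _); apply/funext => a; apply/funext => b.
  by rewrite ractDl ractZl l2.
move=> y xi; have [[_ _ b] _] := ptensor_liftP (lact_form y xi pM).
by rewrite (le_trans (b u))// le_eqVlt; apply/orP; left; apply/eqP; ring.
Qed.

Lemma form_ract_raw_bounded M (phi : B -> dual X -> R[i]^o) u : bounded_form M phi ->
  bounded_form (C * rnorm u * M) (form_ract_raw phi u).
Proof.
move=> pM; have [M0 l1 l2 pb] := pM; split.
- by rewrite !mulr_ge0 ?rnorm_ge0.
- move=> xi k y y'.
  rewrite -(ptensor_lift_linear _ _ (ract_form y xi pM) (ract_form y' xi pM)).
  congr (ptensor_lift _ _); apply/funext => a; apply/funext => b.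
  by rewrite amulDr amulZr l1.
- move=> y k xi xi'.
  rewrite -(ptensor_lift_linear _ _ (ract_form y xi pM) (ract_form y xi' pM)).
  congr (ptensor_lift _ _); apply/funext => a; apply/funext => b.
  by rewrite lactDr lactZr l2.
move=> y xi; have [[_ _ b] _] := ptensor_liftP (ract_form y xi pM).
by rewrite (le_trans (b u))// le_eqVlt; apply/orP; left; apply/eqP; ring.
Qed.

Lemma form_lactE u (phi : V) y xi :
  form_lact u phi y xi = ptensor_lift (fun a b => phi (y ** b) (ract xi a)) u.
Proof.
have [M pM] := form_bounded phi.
by rewrite /form_lact (to_formE (form_lact_raw_bounded u pM)).
Qed.

Lemma form_ractE u (phi : V) y xi :
  form_ract phi u y xi = ptensor_lift (fun a b => phi (b ** y) (lact a xi)) u.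
Proof.
have [M pM] := form_bounded phi.
by rewrite /form_ract (to_formE (form_ract_raw_bounded u pM)).
Qed.

Lemma form_lact_ptens a b (phi : V) y xi :
  form_lact (ptens a b) phi y xi = phi (y ** b) (ract xi a).
Proof.
have [M pM] := form_bounded phi.
by rewrite form_lactE (ptensor_liftP (lact_form y xi pM)).2.
Qed.

Lemma form_ract_ptens a b (phi : V) y xi :
  form_ract phi (ptens a b) y xi = phi (b ** y) (lact a xi).
Proof.
have [M pM] := form_bounded phi.
by rewrite form_ractE (ptensor_liftP (ract_form y xi pM)).2.
Qed.

Lemma form_lact_bounded M u (phi : V) : bounded_form M phi ->
  bounded_form (C * rnorm u * M) (form_lact u phi).
Proof.
move=> pM; rewrite /form_lact (to_formE (form_lact_raw_bounded u pM)).
exact: form_lact_raw_bounded.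
Qed.

Lemma form_ract_bounded M u (phi : V) : bounded_form M phi ->
  bounded_form (C * rnorm u * M) (form_ract phi u).
Proof.
move=> pM; rewrite /form_ract (to_formE (form_ract_raw_bounded u pM)).
exact: form_ract_raw_bounded.
Qed.

Lemma form_lact_bounded_linear M (phi : V) y xi : bounded_form M phi ->
  bounded_linear (M * rnorm y * (C * rnorm xi)) (fun u => form_lact u phi y xi).
Proof.
move=> pM; have -> : (fun u => form_lact u phi y xi) =
    ptensor_lift (fun a b => phi (y ** b) (ract xi a))
  by apply/funext => u; rewrite form_lactE.
exact: (ptensor_liftP (lact_form y xi pM)).1.
Qed.

Lemma form_ract_bounded_linear M (phi : V) y xi : bounded_form M phi ->
  bounded_linear (M * rnorm y * (C * rnorm xi)) (fun u => form_ract phi u y xi).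
Proof.
move=> pM; have -> : (fun u => form_ract phi u y xi) =
    ptensor_lift (fun a b => phi (b ** y) (lact a xi))
  by apply/funext => u; rewrite form_ractE.
exact: (ptensor_liftP (ract_form y xi pM)).1.
Qed.

Lemma form_lact_linear u : linear (form_lact u).
Proof.
move=> k phi psi; apply: form_eq => y xi; rewrite formE !form_lactE.
have [M pM] := form_bounded phi; have [M' qM] := form_bounded psi.
by rewrite -(ptensor_lift_linear _ _ (lact_form y xi pM) (lact_form y xi qM)).
Qed.

Lemma form_ract_linear u : linear (form_ract^~ u).
Proof.
move=> k phi psi; apply: form_eq => y xi; rewrite formE !form_ractE.
have [M pM] := form_bounded phi; have [M' qM] := form_bounded psi.
by rewrite -(ptensor_lift_linear _ _ (ract_form y xi pM) (ract_form y xi qM)).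
Qed.

Lemma form_lact_linearl phi : linear (form_lact^~ phi).
Proof.
move=> k u v; apply: form_eq => y xi; rewrite formE.
have [M pM] := form_bounded phi.
by have [_ /(_ k u v) <- _] := form_lact_bounded_linear y xi pM.
Qed.

Lemma form_ract_linearr phi : linear (form_ract phi).
Proof.
move=> k u v; apply: form_eq => y xi; rewrite formE.
have [M pM] := form_bounded phi.
by have [_ /(_ k u v) <- _] := form_ract_bounded_linear y xi pM.
Qed.

(** Density of the span of elementary tensors, applied to u and v in turn, leaves associativity in B
    and of the action of A. The other module laws and the derivation rule are reduced in the same
    way. *)
Lemma form_lact_mul u v phi : form_lact (u ** v) phi = form_lact u (form_lact v phi).
Proof.
apply: form_eq => y xi; have [M pM] := form_bounded phi.
have fM := form_lact_bounded_linear y xi pM.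
apply: (ptensor_ext (bounded_operator_comp (bounded_linear_amulr v) fM)
  (form_lact_bounded_linear y xi (form_lact_bounded v pM))) => a b /=.
rewrite form_lact_ptens.
apply: (ptensor_ext (bounded_operator_comp (bounded_linear_amull _) fM)
  (form_lact_bounded_linear _ _ pM)) => c d /=.
by rewrite ptens_mul !form_lact_ptens ractA amulA.
Qed.

Lemma form_ract_mul phi u v : form_ract phi (u ** v) = form_ract (form_ract phi u) v.
Proof.
apply: form_eq => y xi; have [M pM] := form_bounded phi.
have fM := form_ract_bounded_linear y xi pM.
apply: (ptensor_ext (bounded_operator_comp (bounded_linear_amull u) fM)
  (form_ract_bounded_linear y xi (form_ract_bounded u pM))) => c d /=.
rewrite form_ract_ptens.
apply: (ptensor_ext (bounded_operator_comp (bounded_linear_amulr _) fM)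
  (form_ract_bounded_linear _ _ pM)) => a b /=.
by rewrite ptens_mul !form_ract_ptens lactA amulA.
Qed.

Lemma form_lractA u phi v : form_ract (form_lact u phi) v = form_lact u (form_ract phi v).
Proof.
apply: form_eq => y xi; have [M pM] := form_bounded phi.
have [M0 _ _ _] := pM.
(* Here u sits inside the outer action, so the bound in u is read off from [form_lact_bounded]. *)
have LM : bounded_linear (C * M * rnorm y * (C * rnorm xi) * rnorm v)
    (fun u => form_ract (form_lact u phi) v y xi).
  split=> [|k w w'|w].
  - by rewrite !mulr_ge0 ?rnorm_ge0.
  - by rewrite form_lact_linearl form_ract_linear.
  have [_ _ b] := form_ract_bounded_linear y xi (form_lact_bounded w pM).
  by rewrite (le_trans (b v))// le_eqVlt; apply/orP; left; apply/eqP; ring.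
apply: (ptensor_ext LM
  (form_lact_bounded_linear y xi (form_ract_bounded v pM))) => a b /=.
rewrite form_lact_ptens.
apply: (ptensor_ext (form_ract_bounded_linear y xi (form_lact_bounded _ pM))
  (form_ract_bounded_linear _ _ pM)) => c d /=.
by rewrite !form_ract_ptens form_lact_ptens lractA amulA.
Qed.

Let N : set (B -> dual X -> R[i]^o) := [set 0].
Let N0 : N 0. Proof. by []. Qed.
Let NP k f g : N f -> N g -> N (k *: f + g).
Proof. by move=> -> ->; rewrite scaler0 addr0. Qed.

Definition form_norm : seminorm V := gauge_seminorm N0 NP.

Lemma form_norm_le M (phi : V) : bounded_form M phi -> form_norm phi <= M.
Proof. by move=> pM; apply: (gauge_le N0); rewrite subr0. Qed.

Lemma le_mul_form_norm c K (phi : V) : 0 <= K ->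
  (forall M, bounded_form M phi -> c <= K * M) -> c <= K * form_norm phi.
Proof.
move=> K0 H; apply: (le_mul_gauge N0) => // M nu ->; rewrite subr0.
exact: H.
Qed.

Lemma form_bimodule : seminormed_bimodule form_norm C form_lact form_ract.
Proof.
split=> //.
- exact: form_lact_linearl.
- exact: form_lact_linear.
- exact: form_ract_linear.
- exact: form_ract_linearr.
- exact: form_lact_mul.
- exact: form_ract_mul.
- exact: form_lractA.
- move=> u phi; apply: le_mul_form_norm => [|M pM].
    by rewrite mulr_ge0 ?rnorm_ge0.
  by apply: form_norm_le; exact: form_lact_bounded.
move=> phi u; apply: le_mul_form_norm => [|M pM].
  by rewrite mulr_ge0 ?rnorm_ge0.
by apply: form_norm_le; exact: form_ract_bounded.
Qed.

Let D_bound := continuous_linear_bound lD cD.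
Let K := projT1 (cid2 D_bound).
Let DK : bounded_linear K D.
Proof. by rewrite /K; case: cid2. Qed.
Let K0 : 0 <= K. Proof. by have [] := DK. Qed.

Let der_form M (phi : B -> dual X -> R[i]^o) : bounded_form M phi ->
  bounded_form (M * 1 * K) (fun (a : A) (b : B) => phi b (D a)).
Proof.
move=> pM; apply: bounded_form_swap.
exact: bounded_form_comp pM (bounded_linear_id B) DK.
Qed.

Lemma form_der_bounded M (phi : V) : bounded_form M phi ->
  bounded_linear (M * 1 * K) (fun u => form_der u phi).
Proof. by move=> pM; exact: (ptensor_liftP (der_form pM)).1. Qed.

Lemma form_der_ptens a b (phi : V) : form_der (ptens a b) phi = phi b (D a).
Proof.
by have [M pM] := form_bounded phi; rewrite /form_der (ptensor_liftP (der_form pM)).2.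
Qed.

Lemma form_der_linear u : linear (form_der u).
Proof.
move=> k phi psi.
have [M pM] := form_bounded phi; have [M' qM] := form_bounded psi.
by rewrite -(ptensor_lift_linear _ _ (der_form pM) (der_form qM)).
Qed.

Lemma form_der_operator u : bounded_operator form_norm (K * rnorm u) (form_der u).
Proof.
have Ku : 0 <= K * rnorm u by rewrite mulr_ge0 ?rnorm_ge0.
split=> // [|phi]; first exact: form_der_linear.
apply: le_mul_form_norm => // M pM; have [_ _ b] := form_der_bounded pM.
by rewrite (le_trans (b u))// le_eqVlt; apply/orP; left; apply/eqP; ring.
Qed.

(** On elementary tensors this is the derivation rule of D in the second variable of [phi], the
    product of the B-parts standing in the first. *)
Lemma form_der_derivation u v phi :
  form_der (u ** v) phi = form_der v (form_ract phi u) + form_der u (form_lact v phi).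
Proof.
have [M pM] := form_bounded phi; have [M0 _ l2 _] := pM.
have fM := form_der_bounded pM.
have rM w : bounded_linear (K * C * M * rnorm w) (fun u => form_der w (form_ract phi u)).
  split=> [|k x y|x].
  - by rewrite !mulr_ge0 ?rnorm_ge0.
  - by rewrite form_ract_linearr form_der_linear.
  have [_ _ b] := form_der_bounded (form_ract_bounded x pM).
  by rewrite (le_trans (b w))// le_eqVlt; apply/orP; left; apply/eqP; ring.
have lM w : bounded_linear (K * C * M * rnorm w) (fun v => form_der w (form_lact v phi)).
  split=> [|k x y|x].
  - by rewrite !mulr_ge0 ?rnorm_ge0.
  - by rewrite form_lact_linearl form_der_linear.
  have [_ _ b] := form_der_bounded (form_lact_bounded x pM).
  by rewrite (le_trans (b w))// le_eqVlt; apply/orP; left; apply/eqP; ring.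
(* Written as a linear combination of functions of u, the sum gets its bound from
   [bounded_operatorP]. *)
have -> : form_der v (form_ract phi u) + form_der u (form_lact v phi) =
  (1 *: (fun u => form_der v (form_ract phi u)) +
   (fun u => form_der u (form_lact v phi))) u.
  by rewrite -[RHS]/(1 *: _ + _) scale1r.
apply: (ptensor_ext (bounded_operator_comp (bounded_linear_amulr v) fM)
  (bounded_operatorP 1 (rM v) (form_der_bounded (form_lact_bounded v pM)))) => a b /=.
have -> : (1 *: (fun u => form_der v (form_ract phi u)) +
    (fun u => form_der u (form_lact v phi))) (ptens a b) =
  (1 *: (fun v => form_der v (form_ract phi (ptens a b))) +
   (fun v => form_der (ptens a b) (form_lact v phi))) v by [].
apply: (ptensor_ext (bounded_operator_comp (bounded_linear_amull _) fM)
  (bounded_operatorP 1 (form_der_bounded (form_ract_bounded _ pM)) (lM _))) => c d /=.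
rewrite -[RHS]/(1 *: form_der _ _ + form_der _ _) scale1r ptens_mul.
rewrite !form_der_ptens form_ract_ptens form_lact_ptens.
by rewrite dD (linear_add (l2 _)).
Qed.

Lemma elementary_form M (h : B -> R[i]^o) (x : X) : bounded_linear M h ->
  bounded_form (M * rnorm x) (fun y (xi : dual X) => h y *: xi x).
Proof.
move=> [M0 lh hM]; split.
- by rewrite mulr_ge0 ?rnorm_ge0.
- by move=> xi k y y'; rewrite lh scalerDl scalerA.
- by move=> y k xi xi'; rewrite dualD dualZ scalerDr !scalerA [k * _]mulrC.
move=> y xi; rewrite (@rnormZ R R[i]^o).
have -> : M * rnorm x * rnorm y * rnorm xi = M * rnorm y * (rnorm xi * rnorm x) by ring.
by rewrite ler_pM ?rnorm_ge0//; exact: le_dual_norm.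
Qed.

(* [T h x] is the value at the form [y, xi |-> h(y) xi(x)] of the functional
   implementing [form_der]. *)
Lemma elementary_inner : amenable U ->
  exists T : (B -> R[i]^o) -> X -> R[i]^o, [/\
    exists2 L, 0 <= L & forall M (h : B -> R[i]^o) x, bounded_linear M h ->
      rnorm (T h x) <= L * M * rnorm x,
    forall M N k (h h' : B -> R[i]^o) x, bounded_linear M h -> bounded_linear N h' ->
      T (k *: h + h') x = k *: T h x + T h' x,
    forall M (h : B -> R[i]^o), bounded_linear M h -> linear (T h) &
    forall M (h : B -> R[i]^o) a b x, bounded_linear M h -> h b *: D a x =
      T (fun y => h (b ** y)) (ract x a) - T (fun y => h (y ** b)) (lact a x)].
Proof.
move=> amU.
have form_derl phi : linear (form_der^~ phi).
  by have [M pM] := form_bounded phi; have [] := form_der_bounded pM.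
have [S [[L [L0 lS SL]] SP]] :=
  amenable_seminormed form_bimodule amU K0 form_derl form_der_operator
    form_der_derivation.
exists (fun h x => S (to_form (fun y (xi : dual X) => h y *: xi x))); split.
- exists L => // M h x hM; rewrite (le_trans (SL _))// -mulrA ler_wpM2l//.
  apply: form_norm_le; rewrite (to_formE (elementary_form x hM)).
  exact: elementary_form.
- move=> M M' k h h' x hM hM'; rewrite -lS; congr (S _).
  rewrite -(to_formP _ (elementary_form x hM) (elementary_form x hM')).
  congr to_form; apply/funext => y; apply/funext => xi.
  rewrite -[LHS]/((k *: h y + h' y) *: _).
  by rewrite scalerDl -scalerA.
- move=> M h hM k x x'; rewrite -lS; congr (S _).
  rewrite -(to_formP _ (elementary_form x hM) (elementary_form x' hM)).
  congr to_form; apply/funext => y; apply/funext => xi.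
  rewrite -[RHS]/(k *: (_ *: _) + _) dual_linear scalerDr !scalerA.
  by rewrite [k * _]mulrC.
move=> M h a b x hM.
have := SP (ptens a b) (to_form (fun y (xi : dual X) => h y *: xi x)).
rewrite form_der_ptens (to_formE (elementary_form x hM)) => ->.
have hl := elementary_form (ract x a) (bounded_operator_comp (bounded_linear_amull b) hM).
have hr := elementary_form (lact a x) (bounded_operator_comp (bounded_linear_amulr b) hM).
congr (S _ - S _); apply: form_eq => y xi.
  by rewrite form_ract_ptens (to_formE (elementary_form x hM)) (to_formE hl) dual_lactE.
by rewrite form_lact_ptens (to_formE (elementary_form x hM)) (to_formE hr) dual_ractE.
Qed.

End operator_bimodule.

(** The assumption on functionals stands in for the Hahn-Banach theorem: a nonzero derivation has a
    nonzero functional <D(.), x> on A, which is traded for a nonzero functional on B. *)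
Lemma amenable_tensor_factor L e : @mixed_identity R B L e ->
  ((exists f : dual A, f != 0) -> exists g : dual B, g != 0) ->
  amenable U -> amenable A.
Proof.
move=> [em eid] nz amU X D cD [lD dD].
have lact0 a : lact a (0 : dual X) = 0.
  apply: (linear_zero (f := fun g : dual X => lact a g)) => k f g.
  by rewrite lactDr lactZr.
have ract0 a : ract (0 : dual X) a = 0.
  apply: (linear_zero (f := fun g : dual X => ract g a)) => k f g.
  by rewrite ractDl ractZl.
have [D0|/existsNP[a0 /eqP Da0]] := pselect (forall a, D a = 0).
  by exists 0 => a; rewrite D0 lact0 ract0 subrr.
have [x0 Dx0] : exists x0, D a0 x0 != 0.
  apply: contrapT => /forallNP H; move/eqP: Da0; apply; apply: dual_eq => x.
  by apply/eqP/negPn/negP; exact: H.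
have [KD KD0 DK] := continuous_linear_bound lD cD.
have [|g g0] := nz.
  have fM : bounded_linear (KD * rnorm x0) (fun a => D a x0).
    split=> [|k a b|a].
    - by rewrite mulr_ge0 ?rnorm_ge0.
    - by rewrite lD dualD dualZ.
    rewrite (le_trans (le_dual_norm _ _))// mulrAC ler_wpM2r ?rnorm_ge0//.
    exact: DK.
  have [f fE _] := bounded_linear_dual fM.
  by exists f; apply: contra_neq Dx0 => f0; rewrite -fE f0.
have gM := dual_bounded_linear g; have [G0 lg gb] := gM.
set G := dual_norm g in gM G0 gb.
have e0 : e 0 = 0.
  apply: bounded_mean0 em.
  split=> // [k y z|y]; first by rewrite /= scaler0 addr0.
  by rewrite rnorm0 mul0r.
(* Otherwise g(c), the mean over d of g(dc), would be 0 for every c. *)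
have [d [c gdc]] : exists d c, g (d ** c) != 0.
  apply: contrapT => H; move/eqP: g0; apply; apply: dual_eq => c.
  rewrite -(eid _ _ c gM).1 -[RHS]e0; congr (e _); apply/funext => d.
  apply/eqP/negPn/negP => gdc; apply: H.
  by exists d, c.
have [T [[M M0 TM] Tl Tx TP]] := elementary_inner lD cD dD amU.
(* This family is stable under translation: for [h d c], the function h(b.) is [h (d ** b) c] and
   h(.b) is [h d (b ** c)]. *)
pose h (v w : B) (y : B) : R[i]^o := g (v ** y ** w).
have hM v w : bounded_linear (G * (rnorm w * rnorm v)) (h v w).
  exact: bounded_operator_comp (bounded_operator_comp (bounded_linear_amull v)
    (bounded_linear_amulr w)) gM.
have lhl w k v v' : h (k *: v + v') w = k *: h v w + h v' w.
  by apply/funext => y; rewrite /h !amulDl !amulZl lg.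
have lhr v k w w' : h v (k *: w + w') = k *: h v w + h v w'.
  by apply/funext => y; rewrite /h amulDr amulZr lg.
have scaleC (z w : R[i]^o) : z *: w = w *: z := mulrC z w.
(* Each of the three terms in the identity for [T] is a bounded functional of db or of bc, so the
   mean over b given by [e] removes b from all of them. *)
have key a x : g (d ** c) *: D a x = T (h d c) (ract x a) - T (h d c) (lact a x).
  have k1 : bounded_linear (M * (G * rnorm c) * rnorm (ract x a))
      (fun v => T (h v c) (ract x a)).
    split=> [|k v v'|v].
    - by rewrite !mulr_ge0 ?rnorm_ge0.
    - by rewrite lhl (Tl _ _ _ _ _ _ (hM _ _) (hM _ _)).
    rewrite (le_trans (TM _ _ _ (hM _ _)))// le_eqVlt; apply/orP; left.
    by apply/eqP; ring.
  have k2 : bounded_linear (M * (G * rnorm d) * rnorm (lact a x))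
      (fun w => T (h d w) (lact a x)).
    split=> [|k v v'|v].
    - by rewrite !mulr_ge0 ?rnorm_ge0.
    - by rewrite lhr (Tl _ _ _ _ _ _ (hM _ _) (hM _ _)).
    rewrite (le_trans (TM _ _ _ (hM _ _)))// le_eqVlt; apply/orP; left.
    by apply/eqP; ring.
  have k3 : bounded_linear (rnorm (D a x) * (G * rnorm c))
      (fun v => D a x *: g (v ** c)).
    split=> [|k v v'|v].
    - by rewrite !mulr_ge0 ?rnorm_ge0.
    - by rewrite amulDl amulZl lg scalerDr !scalerA [k * _]mulrC.
    rewrite (@rnormZ R R[i]^o) -mulrA ler_wpM2l ?rnorm_ge0//.
    rewrite (le_trans (gb _))// -mulrA ler_wpM2l//.
    by rewrite mulrC rnorm_amul.
  have := (eid _ _ d k3).2; rewrite [D a x *: _]scaleC => <-.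
  rewrite -(eid _ _ d k1).2 -(eid _ _ c k2).1.
  have [_ el _] := em.
  have k1' := bounded_operator_comp (bounded_linear_amull d) k1.
  have k2' := bounded_operator_comp (bounded_linear_amulr c) k2.
  rewrite [RHS]addrC -scaleN1r -(el _ _ _ _ _ k2' k1'); congr (e _).
  apply/funext => b /=.
  rewrite -[RHS]/(-1 *: T _ _ + T _ _) scaleN1r addrC [D a x *: _]scaleC.
  rewrite -[LHS]/(h d c b *: D a x) (TP _ _ _ _ _ (hM d c)).
  by congr (T _ _ - T _ _); apply/funext => y; rewrite /h !amulA.
(* Division of [key] by the nonzero scalar g(dc) exhibits the functional implementing D. *)
have Sb : bounded_linear (rnorm (g (d ** c))^-1 * (M * (G * (rnorm c * rnorm d))))
    (fun x => (g (d ** c))^-1 *: T (h d c) x).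
  split=> [|k x x'|x].
  - by rewrite !mulr_ge0 ?rnorm_ge0.
  - by rewrite (Tx _ _ (hM d c)) scalerDr !scalerA [k * _]mulrC.
  by rewrite (@rnormZ R R[i]^o) -mulrA ler_wpM2l ?rnorm_ge0//; exact: TM.
have [S SE _] := bounded_linear_dual Sb.
exists S => a; apply: dual_eq => x.
rewrite dualB dual_lactE dual_ractE !SE -scalerBr -key scalerA mulVf//.
by rewrite scale1r.
Qed.

End tensor_factor.

Theorem mainTheorem1 (R : realType) (A : banachAlgType R[i])
    (hA : has_bounded_approximate_identity A) :
  (amenable A <-> amenable (ptensor A A)) /\
  (amenable A <-> amenable (ptensor A A^op)).
Proof.
have [L [e eid]] := mixed_identity_of_bai hA.
split; split.
- move=> /(amenable_virtual_diagonal eid)[K [mu vd]].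
  exact: virtual_diagonal_amenable (virtual_diagonal_tensor vd vd).
(* Both factors are A, so the nonzero functional on A serves as it is. *)
- exact: amenable_tensor_factor eid id.
- move=> /(amenable_virtual_diagonal eid)[K [mu vd]].
  exact: virtual_diagonal_amenable
    (virtual_diagonal_tensor vd (virtual_diagonal_op vd)).
(* A and its opposite have the same underlying normed space, hence the same functionals. *)
apply: amenable_tensor_factor (mixed_identity_op eid) _ => -[f f0].
by exists (f : dual A^op).
Qed.
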